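(* Let $0<\eta<T$, $0<\alpha<\frac{2T}{\eta^2}$ and $0\le\beta<\frac{2T-\alpha\eta^2}{\alpha\eta^2-2\eta+2T}$ be real constants. Let $f\in C([0,\infty),[0,\infty))$, and let $a\in C([0,T],[0,\infty))$ be such that there exists $t_0\in[\eta,T]$ with $a(t_0)>0$. Let $\gamma$, $\Lambda_1$ and $\Lambda_2$ be the constants defined in the context, and let $\theta_2\ge1$. Assume that (i) there exist constants $\rho_1>0$ and $M_1\in(0,\Lambda_1]$ such that $f(u)\le M_1\rho_1$ for all $u\in[0,\rho_1]$; (ii) the limit $\lim_{u\to\infty}\frac{f(u)}{u}=\beta_1$ exists with $\beta_1\in\left(\frac{\theta_2}{\gamma}\Lambda_2,\infty\right)$; (iii) the limit $\lim_{u\to0^+}\frac{f(u)}{u}=\alpha_2$ exists with $\alpha_2\in\left(\frac{\theta_2}{\gamma}\Lambda_2,\infty\right)$. Then the boundary value problem $$u''(t)+a(t)f(u(t))=0,\quad 0<t<T,\qquad u(0)=\beta u(\eta),\quad u(T)=\alpha\int_0^\eta u(s)\,ds,$$ has at least two positive solutions $u_1$ and $u_2$ such that $0<\|u_1\|<\rho_1<\|u_2\|$.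
   Context: $\|u\|=\max_{t\in[0,T]}|u(t)|$ is the sup norm on $C([0,T],\mathbb{R})$. A positive solution of the boundary value problem is a function $u\in C([0,T])$, twice continuously differentiable on $(0,T)$, satisfying the differential equation on $(0,T)$ and both boundary conditions, with $u(t)\ge0$ on $[0,T]$ and $u(t)>0$ for $t\in(0,T)$. Define $$\gamma=\min\left\{\frac{\eta}{T},\ \frac{\alpha(\beta+1)\eta^2}{2T},\ \frac{\alpha(\beta+1)\eta(T-\eta)}{2T-\alpha(\beta+1)\eta^2}\right\}\in(0,1),$$ $$\Lambda_1=\frac{(2T-\alpha\eta^2)-\beta(\alpha\eta^2-2\eta+2T)}{\left[2(\beta+1)+T^{-1}\beta\eta(\alpha\eta+2)+\alpha\beta T\right]\int_0^T T(T-s)a(s)\,ds},$$ $$\Lambda_2=\frac{(2T-\alpha\eta^2)-\beta(\alpha\eta^2-2\eta+2T)}{2\gamma\eta\int_\eta^T(T-s)a(s)\,ds}.$$ *)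

(* Defs.v *)
From Stdlib Require Import Reals.
From Coquelicot Require Import Coquelicot.
Open Scope R_scope.

(* Functions on an interval are represented by total functions R -> R.
   [continuous_on] is relative continuity (one-sided at the endpoints), and
   every notion below depends only on the values on the interval concerned. *)

Definition Icc (a b x : R) : Prop := a <= x <= b.

(* The supremum of |u| over [0,T]; when u is continuous on [0,T] it is finite
   and attained, so it is the maximum. *)
Definition sup_norm (T : R) (u : R -> R) : R :=
  real (Lub_Rbar (fun y => exists t, 0 <= t <= T /\ y = Rabs (u t))).

(* [Derive] is total, so differentiability of u and of u' has to be required
   separately. *)
Definition C2_at (u : R -> R) (t : R) : Prop :=
  ex_derive u t /\ ex_derive (Derive u) t /\ continuous (Derive_n u 2) t.

Definition bvp_solution (T eta alpha beta : R) (a f u : R -> R) : Prop :=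
  continuous_on (Icc 0 T) u /\
  (forall t, 0 < t < T -> C2_at u t) /\
  (forall t, 0 < t < T -> Derive_n u 2 t + a t * f (u t) = 0) /\
  u 0 = beta * u eta /\
  u T = alpha * RInt u 0 eta.

Definition positive_solution (T eta alpha beta : R) (a f u : R -> R) : Prop :=
  bvp_solution T eta alpha beta a f u /\
  (forall t, 0 <= t <= T -> 0 <= u t) /\
  (forall t, 0 < t < T -> 0 < u t).

Definition gamma (T eta alpha beta : R) : R :=
  Rmin (eta / T)
    (Rmin (alpha * (beta + 1) * eta ^ 2 / (2 * T))
       (alpha * (beta + 1) * eta * (T - eta)
          / (2 * T - alpha * (beta + 1) * eta ^ 2))).

Definition Lambda1 (T eta alpha beta : R) (a : R -> R) : R :=
  ((2 * T - alpha * eta ^ 2)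
     - beta * (alpha * eta ^ 2 - 2 * eta + 2 * T))
  / ((2 * (beta + 1) + / T * beta * eta * (alpha * eta + 2)
        + alpha * beta * T)
     * RInt (fun s => T * (T - s) * a s) 0 T).

Definition Lambda2 (T eta alpha beta : R) (a : R -> R) : R :=
  ((2 * T - alpha * eta ^ 2)
     - beta * (alpha * eta ^ 2 - 2 * eta + 2 * T))
  / (2 * gamma T eta alpha beta * eta
     * RInt (fun s => (T - s) * a s) eta T).

(* Main.v *)
(** The linear problem [-u'' = y] with the two boundary conditions has a unique
    solution [sol y], which is concave and nonnegative when [y] is, and which
    satisfies [min u >= gamma max u] on [[eta, T]]. A solution of the nonlinear
    problem is a fixed point of [u |-> sol (a f(u))].

    Instead of a fixed point index in the cone of concave functions, the proof
    shoots in the plane. With a delay, [-u'' = a(t) (g(u(t - delta)) + c)] is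
    solved explicitly, and continuously in its affine part, although [f] is
    merely continuous. Matching the affine part of [u] with the one of [sol] is
    a system of two equations in two unknowns, solved by the Poincaré-Miranda
    theorem in polar coordinates: the sign of the angular equation comes from
    positivity of [sol], that of the radial one from a priori bounds.

    For the small solution, [f] is frozen above [rho1] and a small constant
    forcing [c] excludes the zero solution; [f(u)/u > Lambda2/gamma] near 0 keeps
    the solutions away from 0 as [c] vanishes. For the large one, the affine part
    is multiplied by a cutoff [X] with [X(m) < m/rho1] below [rho1], so
    that nontrivial fixed points have [max u >= rho1], and a forcing growing with
    the radius replaces the behaviour of [f] at infinity; the a priori bound shows
    that it is inactive at the solutions. Finally [delta] tends to 0 by
    Ascoli's argument. *)

Require Import Defs.
From Stdlib Require Import Reals Lra Lia Classical ClassicalEpsilon FunctionalExtensionality Cantor.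
From Coquelicot Require Import Coquelicot.
Open Scope R_scope.

(** * The Poincaré-Miranda theorem on the square *)

(** The radial signs are those of cone compression and cone expansion. For the small solution the
    balance is nonnegative at a small radius and nonpositive at a large one; for the large solution
    the signs are reversed. Since f(u)/u is large near 0 too, the inner sign of the large problem
    cannot be taken from [f]: it comes from the cutoff, which vanishes there. The affine part is
    described by its values at 0 and T, because both are nonnegative for the linear problem with
    nonnegative right-hand side; the radius is their sum, the angle their proportion. The delay
    costs a factor below 1 in the cone inequality. The growth rate Lambda2/gamma pays for it:
    applied to values at least gamma M, where M is the maximum, it would give u(eta) >= M/gamma
    without delay, and the spare factor 1/gamma exceeds the loss when the delay is small. The bound
    u < rho1 is strict even for M1 = Lambda1; both strict inequalities between the norms and rho1
    rest on this. *)

Inductive label := LA | LB | LC.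

Definition edgeAB (x y : label) : bool :=
  match x, y with LA, LB | LB, LA => true | _, _ => false end.

Definition occurs (l x y z w : label) : Prop := x = l \/ y = l \/ z = l \/ w = l.

(** The sides of a cell form the cycle [x], [y], [w], [z]. Without [LC] the labels take two values
    and return to the first, so they change an even number of times; without [LA] or [LB] there is
    no AB-side. *)
Lemma edgeAB_cycle (x y z w : label) :
  ~ (occurs LA x y z w /\ occurs LB x y z w /\ occurs LC x y z w) ->
  xorb (edgeAB x y) (edgeAB z w) = xorb (edgeAB x z) (edgeAB y w).
Proof.
  unfold occurs; intros H.
  destruct x, y, z, w; try reflexivity; exfalso; apply H; tauto.
Qed.

Fixpoint xsum (h : nat -> bool) (n : nat) : bool :=
  match n with O => false | S k => xorb (xsum h k) (h k) end.

Lemma xsum_false (h : nat -> bool) (n : nat) :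
  (forall i, (i < n)%nat -> h i = false) -> xsum h n = false.
Proof.
  induction n as [|n IH]; intros H; simpl; [reflexivity|].
  rewrite IH by (intros; apply H; lia). rewrite H by lia. reflexivity.
Qed.

(** A discrete Stokes formula modulo 2: a side shared by two cells is counted twice and cancels,
    first within each row, then between rows. *)
Lemma xsum_cells (h v : nat -> nat -> bool) (n m : nat) :
  (forall i j, (i < n)%nat -> (j < m)%nat ->
     xorb (h i j) (h i (S j)) = xorb (v i j) (v (S i) j)) ->
  xorb (xsum (fun i => h i 0%nat) n) (xsum (fun i => h i m) n)
  = xorb (xsum (v 0%nat) m) (xsum (v n) m).
Proof.
  intros H.
  assert (row : forall j k, (j < m)%nat -> (k <= n)%nat ->
    xorb (xsum (fun i => h i j) k) (xsum (fun i => h i (S j)) k)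
    = xorb (v 0%nat j) (v k j)).
  { intros j k Hj; induction k as [|k IH]; intros Hk; simpl.
    - now destruct (v 0%nat j).
    - specialize (IH ltac:(lia)). specialize (H k j ltac:(lia) Hj).
      destruct (xsum (fun i => h i j) k), (xsum (fun i => h i (S j)) k),
        (h k j), (h k (S j)), (v 0%nat j), (v k j), (v (S k) j);
        simpl in *; congruence. }
  assert (col : forall k, (k <= m)%nat ->
    xorb (xsum (fun i => h i 0%nat) n) (xsum (fun i => h i k) n)
    = xorb (xsum (v 0%nat) k) (xsum (v n) k)).
  { intros k; induction k as [|k IH]; intros Hk; simpl.
    - now destruct (xsum (fun i => h i 0%nat) n).
    - specialize (IH ltac:(lia)).
      generalize (row k n ltac:(lia) (Nat.le_refl n)).
      destruct (xsum (fun i => h i 0%nat) n), (xsum (fun i => h i k) n),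
        (xsum (fun i => h i (S k)) n), (xsum (v 0%nat) k), (xsum (v n) k),
        (v 0%nat k), (v n k); simpl in *; congruence. }
  apply col; lia.
Qed.

(** Along a path with two labels only, the ends decide the parity of the number of changes. *)
Lemma xsum_edgeAB (l : nat -> label) (n : nat) :
  (forall i, (i <= n)%nat -> l i <> LC) ->
  xsum (fun i => edgeAB (l i) (l (S i))) n = edgeAB (l 0%nat) (l n).
Proof.
  induction n as [|n IH]; intros H; simpl.
  - now destruct (l 0%nat).
  - rewrite IH by (intros; apply H; lia).
    generalize (H 0%nat ltac:(lia)) (H n ltac:(lia)) (H (S n) ltac:(lia)).
    destruct (l 0%nat), (l n), (l (S n)); simpl; congruence.
Qed.

(* A version of Sperner's lemma on the square: if no cell carried all three
   labels, every cell would have an even number of AB-sides, hence so would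
   the boundary; but its AB-sides all lie on the bottom side, in odd number. *)
Lemma sperner_square (lab : nat -> nat -> label) (n : nat) :
  (forall j, (j <= n)%nat -> lab 0%nat j <> LB) ->
  (forall i, (i <= n)%nat -> lab i 0%nat <> LC) ->
  (forall j, (j <= n)%nat -> lab n j = LB) ->
  (forall i, (i <= n)%nat -> lab i n <> LA) ->
  exists i j, (i < n)%nat /\ (j < n)%nat /\
    forall l, occurs l (lab i j) (lab (S i) j) (lab i (S j)) (lab (S i) (S j)).
Proof.
  intros left bottom right top.
  apply NNPP; intros none.
  assert (cell : forall i j, (i < n)%nat -> (j < n)%nat ->
    xorb (edgeAB (lab i j) (lab (S i) j)) (edgeAB (lab i (S j)) (lab (S i) (S j)))
    = xorb (edgeAB (lab i j) (lab i (S j))) (edgeAB (lab (S i) j) (lab (S i) (S j)))).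
  { intros i j Hi Hj. apply edgeAB_cycle. intros (h1 & h2 & h3). apply none.
    exists i, j. repeat split; trivial. intros []; assumption. }
  generalize (xsum_cells (fun i j => edgeAB (lab i j) (lab (S i) j))
    (fun i j => edgeAB (lab i j) (lab i (S j))) n n cell).
  rewrite (xsum_edgeAB (fun i => lab i 0%nat)) by assumption.
  rewrite (xsum_false (fun i => edgeAB (lab i n) (lab (S i) n))).
  2:{ intros i Hi. generalize (top i ltac:(lia)) (top (S i) ltac:(lia)).
      destruct (lab i n), (lab (S i) n); simpl; congruence. }
  rewrite (xsum_false (fun j => edgeAB (lab 0%nat j) (lab 0%nat (S j)))).
  2:{ intros j Hj. generalize (left j ltac:(lia)) (left (S j) ltac:(lia)).
      destruct (lab 0%nat j), (lab 0%nat (S j)); simpl; congruence. }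
  rewrite (xsum_false (fun j => edgeAB (lab n j) (lab n (S j)))).
  2:{ intros j Hj. rewrite (right j), (right (S j)) by lia. reflexivity. }
  rewrite (right 0%nat) by lia.
  generalize (left 0%nat ltac:(lia)) (bottom 0%nat ltac:(lia)).
  destruct (lab 0%nat 0%nat); simpl; congruence.
Qed.

(** Grid points are labelled by sign: [LB] where F < 0, else [LC] where G < 0, else [LA]. In a small
    cell with all three labels F and G are both close to 0, which is impossible without a common
    zero. *)
Lemma poincare_miranda (F G : R -> R -> R) :
  (forall x y, continuity_2d_pt F x y) ->
  (forall x y, continuity_2d_pt G x y) ->
  (forall y, 0 <= y <= 1 -> 0 <= F 0 y) ->
  (forall y, 0 <= y <= 1 -> F 1 y <= 0) ->
  (forall x, 0 <= x <= 1 -> 0 <= G x 0) ->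
  (forall x, 0 <= x <= 1 -> G x 1 <= 0) ->
  exists x y, 0 <= x <= 1 /\ 0 <= y <= 1 /\ F x y = 0 /\ G x y = 0.
Proof.
  intros cF cG F0 F1 G0 G1.
  apply NNPP; intros none.
  (* Without a zero, F and G vary by less than half of |F| + |G| near each point of the square. The
     radius is doubled to leave room for one mesh width. *)
  assert (Hd : forall u v, exists d : posreal, 0 <= u <= 1 -> 0 <= v <= 1 ->
    forall u' v', Rabs (u' - u) < 2 * d -> Rabs (v' - v) < 2 * d ->
    Rabs (F u' v' - F u v) < (Rabs (F u v) + Rabs (G u v)) / 2 /\
    Rabs (G u' v' - G u v) < (Rabs (F u v) + Rabs (G u v)) / 2).
  { intros u v. destruct (classic (0 <= u <= 1 /\ 0 <= v <= 1)) as [[Hu Hv]|Hn].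
    2:{ exists (mkposreal 1 Rlt_0_1). tauto. }
    assert (Hpos : 0 < (Rabs (F u v) + Rabs (G u v)) / 2).
    { generalize (Rabs_pos (F u v)) (Rabs_pos (G u v)); intros h1 h2.
      destruct (Req_dec (F u v) 0) as [e1|e1].
      - destruct (Req_dec (G u v) 0) as [e2|e2].
        + exfalso; apply none; exists u, v; tauto.
        + generalize (Rabs_pos_lt _ e2); lra.
      - generalize (Rabs_pos_lt _ e1); lra. }
    destruct (cF u v (mkposreal _ Hpos)) as [d1 H1].
    destruct (cG u v (mkposreal _ Hpos)) as [d2 H2].
    assert (Hm : 0 < Rmin d1 d2 / 2).
    { generalize (cond_pos d1) (cond_pos d2); intros.
      apply Rmin_case; lra. }
    exists (mkposreal _ Hm); intros _ _ u' v' hu hv; simpl in *.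
    generalize (Rmin_l d1 d2) (Rmin_r d1 d2); intros.
    split; [apply H1 | apply H2]; lra. }
  pose (delta := fun u v => proj1_sig (constructive_indefinite_description _ (Hd u v))).
  destruct (compactness_value_2d 0 1 0 1 delta) as [d Hcomp].
  destruct (archimed_cor1 d (cond_pos d)) as (n & Hn & Hn0).
  assert (Hn' : 0 < INR n) by (apply lt_0_INR; lia).
  assert (pt : forall i, (i <= n)%nat -> 0 <= INR i / INR n <= 1).
  { intros i Hi. apply le_INR in Hi. generalize (pos_INR i); intros.
    split; [apply Rmult_le_pos; [lra|left; apply Rinv_0_lt_compat; lra]|].
    apply Rmult_le_reg_r with (INR n); [lra|]. field_simplify; lra. }
  assert (step : forall i, INR (S i) / INR n = INR i / INR n + / INR n).
  { intros i; rewrite S_INR; field; lra. }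
  assert (ptn : INR n / INR n = 1) by (field; lra).
  assert (pt0 : INR 0 / INR n = 0) by (simpl; field; lra).
  (* On the sides [i = n] and [j = n] the label is forced, since F and G may vanish there. *)
  pose (lab := fun i j : nat =>
    let x := INR i / INR n in let y := INR j / INR n in
    if Nat.eq_dec i n then LB else if Rlt_dec (F x y) 0 then LB
    else if Nat.eq_dec j n then LC else if Rlt_dec (G x y) 0 then LC else LA).
  assert (labB : forall i j, (i <= n)%nat -> (j <= n)%nat ->
    lab i j = LB -> F (INR i / INR n) (INR j / INR n) <= 0).
  { intros i j Hi Hj; unfold lab.
    destruct (Nat.eq_dec i n) as [->|]; [rewrite ptn; intros _; apply F1, pt, Hj|].
    destruct Rlt_dec; [lra|]. destruct Nat.eq_dec; [easy|]. destruct Rlt_dec; easy. }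
  assert (labC : forall i j, (i <= n)%nat -> (j <= n)%nat ->
    lab i j = LC -> G (INR i / INR n) (INR j / INR n) <= 0).
  { intros i j Hi Hj; unfold lab.
    destruct (Nat.eq_dec i n); [easy|].
    destruct Rlt_dec; [easy|].
    destruct (Nat.eq_dec j n) as [->|]; [rewrite ptn; intros _; apply G1, pt, Hi|].
    destruct Rlt_dec; [lra|easy]. }
  assert (labA : forall i j, lab i j = LA ->
    0 <= F (INR i / INR n) (INR j / INR n) /\ 0 <= G (INR i / INR n) (INR j / INR n)).
  { intros i j; unfold lab.
    destruct (Nat.eq_dec i n); [easy|]. destruct Rlt_dec; [easy|].
    destruct (Nat.eq_dec j n); [easy|]. destruct Rlt_dec; [easy|]. lra. }
  destruct (sperner_square lab n) as (i & j & Hi & Hj & Hl).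
  - intros j Hj. unfold lab. generalize (F0 _ (pt j Hj)); intros.
    rewrite pt0. destruct Nat.eq_dec; [lia|]. destruct Rlt_dec; [lra|].
    destruct Nat.eq_dec; [easy|]. destruct Rlt_dec; easy.
  - intros i Hi. unfold lab. generalize (G0 _ (pt i Hi)); intros. rewrite pt0.
    destruct Nat.eq_dec; [easy|]. destruct Rlt_dec; [easy|].
    destruct Nat.eq_dec; [lia|]. destruct Rlt_dec; [lra|easy].
  - intros j Hj. unfold lab. destruct Nat.eq_dec; [easy|lia].
  - intros i Hi. unfold lab. destruct Nat.eq_dec; [easy|].
    destruct Rlt_dec; [easy|]. destruct Nat.eq_dec; [easy|lia].
  - apply (Hcomp (INR i / INR n) (INR j / INR n)); [apply pt; lia|apply pt; lia|].
    intros (u & v & Hu & Hv & hu & hv & hd).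
    unfold delta in hu, hv, hd.
    destruct (constructive_indefinite_description _ (Hd u v)) as [e He];
      simpl in hu, hv, hd.
    specialize (He Hu Hv).
    set (K := (Rabs (F u v) + Rabs (G u v)) / 2) in *.
    assert (corner : forall i' j', (i' = i \/ i' = S i) -> (j' = j \/ j' = S j) ->
      Rabs (F (INR i' / INR n) (INR j' / INR n) - F u v) < K /\
      Rabs (G (INR i' / INR n) (INR j' / INR n) - G u v) < K).
    { assert (near : forall x w, Rabs (x - w) < e -> Rabs (x + / INR n - w) < 2 * e).
      { intros x w; intros h. assert (0 < / INR n) by (apply Rinv_0_lt_compat; lra).
        apply Rabs_def2 in h. apply Rabs_def1; lra. }
      intros i' j' [->| ->] [->| ->]; apply He; rewrite ?step;
        try (apply near; assumption); generalize (cond_pos e); lra. }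
    assert (pick : forall l, exists i' j', (i' = i \/ i' = S i) /\ (j' = j \/ j' = S j)
      /\ lab i' j' = l).
    { intros l; destruct (Hl l) as [h|[h|[h|h]]]; eauto 10. }
    destruct (pick LA) as (ia & ja & h1 & h2 & ha).
    destruct (pick LB) as (ib & jb & h3 & h4 & hb).
    destruct (pick LC) as (ic & jc & h5 & h6 & hc).
    (* The [LA] corner has F, G >= 0, the [LB] corner F <= 0 and the [LC] corner G <= 0, so |F| and
       |G| at (u, v) are both below [K], whose double is |F| + |G|. *)
    apply labA in ha. apply labB in hb; [|lia|lia]. apply labC in hc; [|lia|lia].
    destruct (corner _ _ h1 h2) as [ca1 ca2].
    destruct (corner _ _ h3 h4) as [cb1 _].
    destruct (corner _ _ h5 h6) as [_ cc2].
    apply Rabs_def2 in ca1, ca2, cb1, cc2.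
    assert (Rabs (F u v) < K) by (apply Rabs_def1; lra).
    assert (Rabs (G u v) < K) by (apply Rabs_def1; lra).
    unfold K in *; lra.
Qed.

(** * Iterated primitives of continuous functions *)

Definition cont (y : R -> R) : Prop := forall t, continuous y t.

(** Applied twice, it gives the integral of (t - s) y(s) over [0, t], which solves u'' = y with zero
    initial data. *)
Definition prim (y : R -> R) (t : R) : R := RInt y 0 t.

Lemma cont_ex_RInt (y : R -> R) (a b : R) : cont y -> ex_RInt y a b.
Proof. intros cy. apply (ex_RInt_continuous (V := R_CompleteNormedModule)); intros; apply cy. Qed.

Lemma is_derive_prim (y : R -> R) (t : R) : cont y -> is_derive (prim y) t (y t).
Proof.
  intros cy. apply (is_derive_RInt (V := R_NormedModule) y (prim y) 0 t).
  - apply filter_forall; intros b. apply (RInt_correct (V := R_CompleteNormedModule)).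
    now apply cont_ex_RInt.
  - apply cy.
Qed.

Lemma is_derive_cont (u du : R -> R) : (forall t, is_derive u t (du t)) -> cont u.
Proof.
  intros H t. apply (ex_derive_continuous (V := R_NormedModule)). exists (du t). apply H.
Qed.

Lemma cont_prim (y : R -> R) : cont y -> cont (prim y).
Proof. intros cy. apply is_derive_cont with y. intros; now apply is_derive_prim. Qed.

Lemma prim_0 (y : R -> R) : prim y 0 = 0.
Proof. apply (RInt_point (V := R_CompleteNormedModule)). Qed.

Lemma prim_ext (y z : R -> R) (T t : R) :
  (forall s, 0 <= s <= T -> y s = z s) -> 0 <= t <= T -> prim y t = prim z t.
Proof.
  intros H Ht. apply (RInt_ext (V := R_CompleteNormedModule)). intros s.
  rewrite Rmin_left, Rmax_right by lra. intros; apply H; lra.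
Qed.

Lemma prim_comb (k l : R) (y z : R -> R) : cont y -> cont z ->
  prim (fun s => k * y s + l * z s) = (fun t => k * prim y t + l * prim z t).
Proof.
  intros cy cz. apply functional_extensionality; intros t. unfold prim.
  generalize (RInt_plus (V := R_CompleteNormedModule) (fun s => scal k (y s)) (fun s => scal l (z s)) 0 t).
  rewrite !(RInt_scal (V := R_CompleteNormedModule)) by now apply cont_ex_RInt.
  intros H; apply H; apply (ex_RInt_scal (V := R_NormedModule)); now apply cont_ex_RInt.
Qed.

Lemma cont_comb (k l : R) (y z : R -> R) : cont y -> cont z ->
  cont (fun s => k * y s + l * z s).
Proof.
  intros cy cz t. apply (continuous_plus (V := R_NormedModule)).
  - apply (continuous_scal_r (V := R_NormedModule)), cy.
  - apply (continuous_scal_r (V := R_NormedModule)), cz.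
Qed.

Lemma prim_le (y z : R -> R) (T t : R) : cont y -> cont z ->
  (forall s, 0 <= s <= T -> y s <= z s) -> 0 <= t <= T -> prim y t <= prim z t.
Proof.
  intros cy cz H Ht. apply RInt_le; try lra; try now apply cont_ex_RInt.
  intros; apply H; lra.
Qed.

Lemma prim_const (c t : R) : prim (fun _ => c) t = t * c.
Proof.
  unfold prim. rewrite (RInt_const (V := R_CompleteNormedModule)).
  unfold scal; simpl; unfold mult; simpl. ring.
Qed.

Lemma cont_const (c : R) : cont (fun _ => c).
Proof. intros t. apply continuous_const. Qed.

Lemma prim_close (y z : R -> R) (d T t : R) : cont y -> cont z ->
  (forall s, 0 <= s <= T -> Rabs (y s - z s) <= d) -> 0 <= t <= T ->
  Rabs (prim y t - prim z t) <= T * d.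
Proof.
  intros cy cz H Ht.
  replace (prim y t - prim z t) with (prim (fun s => 1 * y s + (-1) * z s) t)
    by (rewrite prim_comb by assumption; ring).
  apply Rle_trans with ((t - 0) * d).
  - apply abs_RInt_le_const; [lra|now apply cont_ex_RInt, cont_comb|].
    intros s Hs. replace (1 * y s + -1 * z s) with (y s - z s) by ring. apply H; lra.
  - assert (0 <= d) by (eapply Rle_trans; [apply Rabs_pos|apply (H 0); lra]).
    rewrite Rminus_0_r. apply Rmult_le_compat_r; lra.
Qed.

Lemma prim_nonneg (y : R -> R) (T t : R) : cont y ->
  (forall s, 0 <= s <= T -> 0 <= y s) -> 0 <= t <= T -> 0 <= prim y t.
Proof.
  intros cy H Ht. replace 0 with (prim (fun _ => 0) t) by (rewrite prim_const; ring).
  apply prim_le with T; auto using cont_const.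
Qed.

Lemma RInt_pos (y : R -> R) (l r c : R) : cont y -> (forall s, l <= s <= r -> 0 <= y s) ->
  l <= c <= r -> 0 < y c -> l < r -> 0 < RInt y l r.
Proof.
  intros cy y0 Hc yc Hlr.
  assert (Hn : locally c (fun s => 0 < y s)).
  { apply (cy c). apply (open_gt 0). assumption. }
  destruct Hn as [e He].
  (* [c] may be an endpoint, so its neighbourhood is cut to [l, r]. *)
  set (p := Rmax l (c - e / 2)). set (q := Rmin r (c + e / 2)).
  generalize (cond_pos e); intros He0.
  assert (Hpq : l <= p < q /\ q <= r /\ c - e < p /\ q < c + e).
  { unfold p, q. apply Rmax_case_strong; apply Rmin_case_strong; lra. }
  rewrite <- (RInt_Chasles (V := R_CompleteNormedModule) y l p r) by now apply cont_ex_RInt.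
  rewrite <- (RInt_Chasles (V := R_CompleteNormedModule) y p q r) by now apply cont_ex_RInt.
  unfold plus; simpl.
  assert (0 <= RInt y l p).
  { apply RInt_ge_0; [lra|now apply cont_ex_RInt|]. intros; apply y0; lra. }
  assert (0 <= RInt y q r).
  { apply RInt_ge_0; [lra|now apply cont_ex_RInt|]. intros; apply y0; lra. }
  assert (0 < RInt y p q).
  { apply RInt_gt_0; [lra| |intros; apply cy].
    intros x Hx. apply He. unfold ball; simpl; unfold AbsRing_ball, abs, minus, plus, opp; simpl.
    apply Rabs_def1; lra. }
  lra.
Qed.

Lemma prim_mono (y : R -> R) (s t : R) : cont y -> (forall r, 0 <= y r) ->
  s <= t -> prim y s <= prim y t.
Proof.
  intros cy y0 Hst. unfold prim.
  rewrite <- (RInt_Chasles (V := R_CompleteNormedModule) y 0 s t) by now apply cont_ex_RInt.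
  unfold plus; simpl.
  assert (0 <= RInt y s t) by (apply RInt_ge_0; [lra|now apply cont_ex_RInt|auto]). lra.
Qed.

(** Convexity of the double primitive: its derivative [prim y] is nondecreasing, so the mean value
    theorem traps the slope of a chord between the slopes at its ends. *)
Lemma prim2_slope (y : R -> R) (s t : R) : cont y -> (forall r, 0 <= y r) -> s <= t ->
  (t - s) * prim y s <= prim (prim y) t - prim (prim y) s <= (t - s) * prim y t.
Proof.
  intros cy y0 Hst.
  destruct (MVT_gen (prim (prim y)) s t (prim y)) as (c & Hc & ->).
  - intros x _. now apply is_derive_prim, cont_prim.
  - intros x _. apply continuity_pt_filterlim. now apply cont_prim, cont_prim.
  - rewrite Rmin_left, Rmax_right in Hc by assumption.
    generalize (prim_mono y s c cy y0 (proj1 Hc)) (prim_mono y c t cy y0 (proj2 Hc)); intros.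
    split; [rewrite (Rmult_comm (t - s))|rewrite (Rmult_comm (t - s))];
      apply Rmult_le_compat_r; lra.
Qed.

(** Taylor's formula at [c] with integral remainder. The integrand is the derivative of (T - s)
    [prim y s] + [prim (prim y) s]. *)
Lemma prim2_taylor (y : R -> R) (c T : R) : cont y ->
  RInt (fun s => (T - s) * y s) c T
  = prim (prim y) T - prim (prim y) c - (T - c) * prim y c.
Proof.
  intros cy.
  replace (_ - _ - _) with
    (((T - T) * prim y T + prim (prim y) T) - ((T - c) * prim y c + prim (prim y) c)) by ring.
  apply (is_RInt_unique (V := R_CompleteNormedModule)).
  apply (is_RInt_derive (V := R_CompleteNormedModule) (fun s => (T - s) * prim y s + prim (prim y) s)).
  - intros s _. auto_derive.
    + repeat split; eexists; [apply (is_derive_prim y s cy)|].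
      apply is_derive_prim, cont_prim, cy.
    + assert (e1 : Derive (fun x => prim y x) s = y s)
        by apply is_derive_unique, is_derive_prim, cy.
      assert (e2 : Derive (fun x => prim (prim y) x) s = prim y s)
        by apply is_derive_unique, is_derive_prim, cont_prim, cy.
      rewrite e1, e2. ring.
  - intros s _. apply (continuous_mult (K := R_AbsRing) (fun s => T - s)); [|apply cy].
    apply (continuous_minus (V := R_NormedModule)); [apply continuous_const|apply continuous_id].
Qed.

Lemma prim2_nonneg (y : R -> R) (t : R) : cont y -> (forall r, 0 <= y r) ->
  0 <= t -> 0 <= prim (prim y) t.
Proof.
  intros cy y0 Ht. apply prim_nonneg with t; [now apply cont_prim| |lra].
  intros s Hs. apply prim_nonneg with s; auto; lra.
Qed.

(** A convex function vanishing at 0 lies below its chords from 0. *)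
Lemma prim2_star (y : R -> R) (s t : R) : cont y -> (forall r, 0 <= y r) ->
  0 <= s <= t -> t * prim (prim y) s <= s * prim (prim y) t.
Proof.
  intros cy y0 Hst.
  destruct (prim2_slope y 0 s cy y0) as [_ h1]; [lra|].
  destruct (prim2_slope y s t cy y0) as [h2 _]; [lra|].
  rewrite !prim_0 in *. nra.
Qed.

(** The integral of [prim (prim y)] over [0, t] is at most the area of the triangle under its chord
    from 0. *)
Lemma prim3_le (y : R -> R) (t : R) : cont y -> (forall r, 0 <= y r) ->
  0 < t -> 2 * prim (prim (prim y)) t <= t * prim (prim y) t.
Proof.
  intros cy y0 Ht. set (k := prim (prim y) t / t).
  assert (H : prim (prim (prim y)) t <= prim (fun s => k * s) t).
  { apply prim_le with t; [now apply cont_prim, cont_prim| | |lra].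
    - intros s. apply (continuous_scal_r (V := R_NormedModule) k (fun s => s)), continuous_id.
    - intros s Hs. unfold k. apply Rmult_le_reg_r with t; [lra|].
      field_simplify; [|lra]. generalize (prim2_star y s t cy y0 Hs); lra. }
  replace (prim (fun s => k * s) t) with (k * t ^ 2 / 2 - k * 0 ^ 2 / 2) in H.
  - replace (t * prim (prim y) t) with (k * t ^ 2) by (unfold k; field; lra).
    lra.
  - symmetry. apply (is_RInt_unique (V := R_CompleteNormedModule)).
    apply (is_RInt_derive (V := R_CompleteNormedModule) (fun s => k * s ^ 2 / 2)).
    + intros s _. auto_derive; [trivial|]. simpl. field.
    + intros s _. apply (continuous_scal_r (V := R_NormedModule) k (fun s => s)), continuous_id.
Qed.

(** * Suprema and the delayed equation *)

Lemma cont_comp (g u : R -> R) : cont g -> cont u -> cont (fun t => g (u t)).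
Proof. intros cg cu t. apply (continuous_comp u g); [apply cu|apply cg]. Qed.

Lemma cont_mult (u v : R -> R) : cont u -> cont v -> cont (fun t => u t * v t).
Proof. intros cu cv t. apply (continuous_mult (K := R_AbsRing)); [apply cu|apply cv]. Qed.

Lemma cont_plus (u v : R -> R) : cont u -> cont v -> cont (fun t => u t + v t).
Proof. intros cu cv t. apply (continuous_plus (V := R_NormedModule)); [apply cu|apply cv]. Qed.

Lemma cont_minus (u v : R -> R) : cont u -> cont v -> cont (fun t => u t - v t).
Proof. intros cu cv t. apply (continuous_minus (V := R_NormedModule)); [apply cu|apply cv]. Qed.

Lemma cont_id : cont (fun t => t).
Proof. intros t. apply continuous_id. Qed.

Lemma cont_lipschitz (L : R) (u : R -> R) : 0 < L ->
  (forall s t, Rabs (u t - u s) <= L * Rabs (t - s)) -> cont u.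
Proof.
  intros HL H t. apply continuity_pt_filterlim. intros e He. exists (e / L).
  split; [now apply Rdiv_lt_0_compat|].
  intros x [_ Hx]. simpl in *. unfold Rdist in *.
  eapply Rle_lt_trans; [apply H|].
  apply Rmult_lt_compat_l with (r := L) in Hx; [|assumption].
  replace (L * (e / L)) with e in Hx by (field; lra). assumption.
Qed.

Lemma cont_Rmax (c : R) : cont (Rmax c).
Proof.
  apply cont_lipschitz with 1; [lra|]. intros s t. rewrite Rmult_1_l.
  unfold Rmax. destruct (Rle_dec c t), (Rle_dec c s); unfold Rabs; repeat destruct Rcase_abs; lra.
Qed.

Lemma cont_Rmin (c : R) : cont (Rmin c).
Proof.
  apply cont_lipschitz with 1; [lra|]. intros s t. rewrite Rmult_1_l.
  unfold Rmin. destruct (Rle_dec c t), (Rle_dec c s); unfold Rabs; repeat destruct Rcase_abs; lra.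
Qed.

Lemma cont_Rabs : cont Rabs.
Proof. apply cont_lipschitz with 1; [lra|]. intros s t. rewrite Rmult_1_l. apply Rabs_triang_inv2. Qed.

Definition clamp (T t : R) : R := Rmax 0 (Rmin T t).

Lemma cont_clamp (T : R) : cont (clamp T).
Proof. exact (cont_comp (Rmax 0) (Rmin T) (cont_Rmax 0) (cont_Rmin T)). Qed.

Lemma clamp_bounds (T t : R) : 0 <= T -> 0 <= clamp T t <= T.
Proof. intros HT. unfold clamp. apply Rmax_case_strong; apply Rmin_case_strong; lra. Qed.

Lemma clamp_id (T t : R) : 0 <= t <= T -> clamp T t = t.
Proof. intros Ht. unfold clamp. rewrite Rmin_right, Rmax_right; lra. Qed.

Lemma clamp_lipschitz (T s t : R) : Rabs (clamp T t - clamp T s) <= Rabs (t - s).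
Proof.
  unfold clamp, Rmax, Rmin. repeat destruct Rle_dec; unfold Rabs; repeat destruct Rcase_abs; lra.
Qed.

Lemma sup_norm_spec (T : R) (u : R -> R) : 0 <= T -> cont u ->
  (forall t, 0 <= t <= T -> Rabs (u t) <= sup_norm T u) /\
  exists t, 0 <= t <= T /\ sup_norm T u = Rabs (u t).
Proof.
  intros HT cu.
  destruct (continuity_ab_maj (fun t => Rabs (u t)) 0 T HT) as (x & Hx & Hx').
  { intros c _. apply continuity_pt_filterlim. apply (cont_comp Rabs u cont_Rabs cu). }
  assert (e : sup_norm T u = Rabs (u x)).
  { unfold sup_norm. rewrite (is_lub_Rbar_unique _ (Finite (Rabs (u x)))); [reflexivity|].
    split.
    - intros y (t & Ht & ->). simpl. now apply Hx.
    - intros b Hb. apply Hb. exists x. auto. }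
  split; [intros t Ht; rewrite e; now apply Hx|]. exists x. auto.
Qed.

(** Shooting curves may become negative, and only their positive part has to be measured. For
    functions that are nonnegative on [0, T] this is the sup norm. *)
Definition sup_pos (T : R) (u : R -> R) : R := sup_norm T (fun t => Rmax 0 (u t)).

Lemma sup_pos_spec (T : R) (u : R -> R) : 0 <= T -> cont u ->
  (forall t, 0 <= t <= T -> u t <= sup_pos T u) /\
  exists t, 0 <= t <= T /\ sup_pos T u = Rmax 0 (u t).
Proof.
  intros HT cu.
  destruct (sup_norm_spec T (fun t => Rmax 0 (u t)) HT) as [h1 (x & Hx & h2)].
  { apply cont_comp; [apply cont_Rmax|assumption]. }
  fold (sup_pos T u) in h1, h2. split.
  - intros t Ht. apply Rle_trans with (2 := h1 t Ht).
    apply Rle_trans with (2 := Rle_abs _). apply Rmax_r.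
  - exists x. split; [assumption|]. rewrite h2. apply Rabs_pos_eq, Rmax_l.
Qed.

Lemma sup_pos_nonneg (T : R) (u : R -> R) : 0 <= T -> cont u -> 0 <= sup_pos T u.
Proof.
  intros HT cu. destruct (sup_pos_spec T u HT cu) as [_ (x & _ & ->)]. apply Rmax_l.
Qed.

Lemma sup_pos_le (T M : R) (u : R -> R) : 0 <= T -> cont u -> 0 <= M ->
  (forall t, 0 <= t <= T -> u t <= M) -> sup_pos T u <= M.
Proof.
  intros HT cu HM H. destruct (sup_pos_spec T u HT cu) as [_ (x & Hx & ->)].
  apply Rmax_lub; auto.
Qed.

Lemma sup_pos_close (T d : R) (u v : R -> R) : 0 <= T -> cont u -> cont v ->
  (forall t, 0 <= t <= T -> Rabs (u t - v t) <= d) ->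
  Rabs (sup_pos T u - sup_pos T v) <= d.
Proof.
  intros HT cu cv H.
  assert (d0 : 0 <= d) by (eapply Rle_trans; [apply Rabs_pos|apply (H 0); lra]).
  generalize (sup_pos_nonneg T u HT cu) (sup_pos_nonneg T v HT cv); intros.
  destruct (sup_pos_spec T u HT cu) as [hu _]. destruct (sup_pos_spec T v HT cv) as [hv _].
  assert (sup_pos T u <= sup_pos T v + d).
  { apply sup_pos_le; auto; [lra|]. intros t Ht.
    generalize (H t Ht) (hv t Ht); intros h. apply Rabs_le_between in h. lra. }
  assert (sup_pos T v <= sup_pos T u + d).
  { apply sup_pos_le; auto; [lra|]. intros t Ht.
    generalize (H t Ht) (hu t Ht); intros h. apply Rabs_le_between in h. lra. }
  apply Rabs_le; lra.
Qed.

Lemma cont_bounded (T : R) (u : R -> R) : 0 <= T -> cont u ->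
  exists M, 0 <= M /\ forall t, 0 <= t <= T -> Rabs (u t) <= M.
Proof.
  intros HT cu. destruct (sup_norm_spec T u HT cu) as [h _].
  exists (sup_norm T u). split; [|exact h].
  eapply Rle_trans; [apply Rabs_pos|apply (h 0); lra].
Qed.

(** Uniform continuity of [g] on [-(M + 1), M + 1]; the margin 1 makes room for [v], which is only
    close to the range of [u]. *)
Lemma comp_close (T : R) (g u : R -> R) (e : R) : 0 <= T -> cont g -> cont u -> 0 < e ->
  exists d, 0 < d /\ forall t v, 0 <= t <= T -> Rabs (v - u t) <= d ->
    Rabs (g v - g (u t)) <= e.
Proof.
  intros HT cg cu He.
  destruct (cont_bounded T u HT cu) as (M & M0 & HM).
  destruct (@Heine_cor2 g (- (M + 1)) (M + 1)
    (fun x _ => proj2 (continuity_pt_filterlim _ x) (cg x)) (mkposreal e He)) as [d Hd].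
  exists (Rmin (d / 2) 1). split.
  - apply Rmin_pos; [generalize (cond_pos d)|]; lra.
  - intros t v Ht Hv. left. apply (Hd v (u t)).
    + generalize (HM t Ht) (Rle_trans _ _ _ Hv (Rmin_r _ _)); intros h1 h2.
      apply Rabs_le_between in h1, h2. lra.
    + generalize (HM t Ht); intros h1. apply Rabs_le_between in h1. lra.
    + generalize (Rle_trans _ _ _ Hv (Rmin_l _ _)) (cond_pos d). lra.
Qed.

Lemma continuity_2d_comp (X p q : R -> R -> R) (x y : R) :
  (forall m r, continuity_2d_pt X m r) ->
  continuity_2d_pt p x y -> continuity_2d_pt q x y ->
  continuity_2d_pt (fun u v => X (p u v) (q u v)) x y.
Proof.
  intros cX cp cq e.
  destruct (cX (p x y) (q x y) e) as [d Hd].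
  destruct (cp d) as [d1 H1]. destruct (cq d) as [d2 H2].
  assert (Hm : 0 < Rmin d1 d2) by (apply Rmin_pos; [apply d1|apply d2]).
  exists (mkposreal _ Hm). simpl. intros u v hu hv.
  generalize (Rmin_l d1 d2) (Rmin_r d1 d2); intros.
  apply Hd; [apply H1|apply H2]; lra.
Qed.

(** * The delayed equation, solved by the method of steps *)

Section DelayedProblem.

Variables (T : R) (a g : R -> R) (delta : R).
Hypothesis HT : 0 < T.
Hypothesis Hdelta : 0 < delta.
Hypothesis ca : cont a.
Hypothesis cg : cont g.

(** For s < delta the clamp reads the value at 0, so no history before time 0 has to be
    prescribed. *)
Definition forcing (u : R -> R) (c s : R) : R := a s * (g (u (clamp T (s - delta))) + c).

Fixpoint delayed (k : nat) (l : R -> R) (c : R) : R -> R :=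
  match k with
  | O => l
  | S k => fun t => l t - prim (prim (forcing (delayed k l c) c)) t
  end.

Lemma cont_forcing (u : R -> R) (c : R) : cont u -> cont (forcing u c).
Proof.
  intros cu. apply cont_mult; [assumption|]. apply cont_plus; [|apply cont_const].
  apply (cont_comp g); [assumption|]. apply (cont_comp u); [assumption|].
  apply (cont_comp (clamp T)); [apply cont_clamp|].
  apply cont_minus; [apply cont_id|apply cont_const].
Qed.

Lemma cont_delayed (k : nat) (l : R -> R) (c : R) : cont l -> cont (delayed k l c).
Proof.
  intros cl; induction k as [|k IH]; [assumption|].
  apply cont_minus; [assumption|]. now apply cont_prim, cont_prim, cont_forcing.
Qed.

(* On [[0, k delta]] the forcing only looks at values that the first [k]
   iterations have already settled. *)
Lemma delayed_stable (k : nat) (l : R -> R) (c t : R) : 0 <= t <= INR k * delta ->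
  delayed (S k) l c t = delayed k l c t.
Proof.
  revert t; induction k as [|k IH]; intros t Ht.
  - simpl in *. replace t with 0 by lra. rewrite prim_0. ring.
  - change (l t - prim (prim (forcing (delayed (S k) l c) c)) t
      = l t - prim (prim (forcing (delayed k l c) c)) t).
    f_equal. apply prim_ext with t; [|lra]. intros s Hs.
    apply prim_ext with s; [|lra]. intros r Hr.
    unfold forcing. rewrite IH; [reflexivity|].
    rewrite S_INR in Ht. split; [apply Rmax_l|].
    apply Rmax_lub; [apply Rmult_le_pos; [apply pos_INR|lra]|].
    apply Rle_trans with (1 := Rmin_r _ _). lra.
Qed.

Lemma forcing_close (u : R -> R) (c e : R) : cont u -> 0 < e ->
  exists d, 0 < d /\ forall u' c',
    (forall t, 0 <= t <= T -> Rabs (u' t - u t) <= d) -> Rabs (c' - c) <= d ->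
    forall s, 0 <= s <= T -> Rabs (forcing u' c' s - forcing u c s) <= e.
Proof.
  intros cu He.
  destruct (cont_bounded T a (Rlt_le _ _ HT) ca) as (M & M0 & HM).
  (* Half of the error is left to [g] and half to [c]; [M + 1] is positive even if [M] is 0. *)
  assert (He' : 0 < e / (2 * (M + 1))) by (apply Rdiv_lt_0_compat; lra).
  destruct (comp_close T g u _ (Rlt_le _ _ HT) cg cu He') as (d & d0 & Hd).
  exists (Rmin d (e / (2 * (M + 1)))). split; [now apply Rmin_pos|].
  intros u' c' Hu Hc s Hs. unfold forcing. rewrite <- Rmult_minus_distr_l, Rabs_mult.
  set (s' := clamp T (s - delta)).
  assert (Hs' : 0 <= s' <= T) by (apply clamp_bounds; lra).
  assert (h : Rabs (g (u' s') + c' - (g (u s') + c)) <= 2 * (e / (2 * (M + 1)))).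
  { replace (_ - _) with ((g (u' s') - g (u s')) + (c' - c)) by ring.
    eapply Rle_trans; [apply Rabs_triang|].
    generalize (Hd s' (u' s') Hs' (Rle_trans _ _ _ (Hu s' Hs') (Rmin_l _ _))).
    generalize (Rle_trans _ _ _ Hc (Rmin_r _ _)). lra. }
  apply Rle_trans with ((M + 1) * (2 * (e / (2 * (M + 1))))).
  - apply Rmult_le_compat; try apply Rabs_pos; [|assumption]. generalize (HM s Hs); lra.
  - right. field. lra.
Qed.

(** Each of the finitely many substitutions is continuous at the given curve. A Gronwall estimate,
    which would ask for a Lipschitz [g], is thus avoided. *)
Lemma delayed_close (k : nat) (l : R -> R) (c e : R) : cont l -> 0 < e ->
  exists d, 0 < d /\ forall l' c', cont l' ->
    (forall t, 0 <= t <= T -> Rabs (l' t - l t) <= d) -> Rabs (c' - c) <= d ->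
    forall t, 0 <= t <= T -> Rabs (delayed k l' c' t - delayed k l c t) <= e.
Proof.
  intros cl. revert e; induction k as [|k IH]; intros e He.
  { exists e. auto. }
  assert (TT : 0 < T * T) by nra.
  assert (He' : 0 < e / (2 * (T * T))) by (apply Rdiv_lt_0_compat; lra).
  destruct (forcing_close (delayed k l c) c _ (cont_delayed k l c cl) He') as (d1 & d10 & H1).
  destruct (IH d1 d10) as (d2 & d20 & H2).
  exists (Rmin (Rmin d1 d2) (e / 2)). split; [repeat apply Rmin_pos; lra|].
  intros l' c' cl' Hl Hc t Ht. simpl.
  generalize (Rmin_l (Rmin d1 d2) (e / 2)) (Rmin_r (Rmin d1 d2) (e / 2))
    (Rmin_l d1 d2) (Rmin_r d1 d2); intros.
  set (y' := forcing (delayed k l' c') c'). set (y := forcing (delayed k l c) c).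
  assert (h : Rabs (prim (prim y') t - prim (prim y) t) <= T * (T * (e / (2 * (T * T))))).
  { assert (cont y') by now apply cont_forcing, cont_delayed.
    assert (cont y) by now apply cont_forcing, cont_delayed.
    apply prim_close; auto using cont_prim. intros s Hs.
    apply prim_close; auto. intros r Hr. apply H1; [|lra|assumption].
    apply H2; [assumption| |lra]. intros r' Hr'. generalize (Hl r' Hr'); lra. }
  replace (T * (T * (e / (2 * (T * T))))) with (e / 2) in h by (field; lra).
  generalize (Hl t Ht); intros h2. apply Rabs_le_between in h, h2. apply Rabs_le; lra.
Qed.

End DelayedProblem.

(** * Uniform cluster points of equi-Lipschitz sequences *)

(** A single index [n] serves all coordinates below [K]; this is what replaces a diagonal
    subsequence. *)
Definition common_cluster (x : nat -> nat -> R) (l : nat -> R) (K : nat) : Prop :=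
  forall e N, 0 < e -> exists n, (N <= n)%nat /\ forall k, (k < K)%nat -> Rabs (x n k - l k) < e.

Lemma archimed_INR (e : R) : 0 < e -> exists N, forall n, (N <= n)%nat -> / INR (S n) < e.
Proof.
  intros He. destruct (archimed_cor1 e He) as (N & HN & HN0). exists N. intros n Hn.
  apply Rle_lt_trans with (2 := HN). apply Rinv_le_contravar.
  - now apply lt_0_INR.
  - apply le_INR. lia.
Qed.

(** Bolzano-Weierstrass is applied to coordinate [K] along indices on which the first [K]
    coordinates already converge to [l]. *)
Lemma common_cluster_step (x : nat -> nat -> R) (M : R) (l : nat -> R) (K : nat) :
  (forall n k, Rabs (x n k) <= M) -> common_cluster x l K ->
  exists v, common_cluster x (fun k => if Nat.eq_dec k K then v else l k) (S K).
Proof.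
  intros HM Hl.
  assert (Hn : forall i, exists n, (i <= n)%nat /\
    forall k, (k < K)%nat -> Rabs (x n k - l k) < / INR (S i)).
  { intros i. apply Hl. apply Rinv_0_lt_compat, lt_0_INR; lia. }
  pose (sel := fun i => proj1_sig (constructive_indefinite_description _ (Hn i))).
  assert (Hsel : forall i, (i <= sel i)%nat /\
    forall k, (k < K)%nat -> Rabs (x (sel i) k - l k) < / INR (S i)).
  { intros i. unfold sel. now destruct constructive_indefinite_description. }
  destruct (Bolzano_Weierstrass (fun i => x (sel i) K) (fun c => - M <= c <= M)) as [v Hv].
  { apply compact_P3. }
  { intros i. apply Rabs_le_between, HM. }
  exists v. intros e N He.
  destruct (archimed_INR e He) as [N1 HN1].
  destruct (Hv (disc v (mkposreal e He)) (max N N1)) as (p & Hp & Hd).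
  { exists (mkposreal e He). intros y Hy; exact Hy. }
  exists (sel p). destruct (Hsel p) as [h1 h2]. split; [lia|].
  intros k Hk. destruct Nat.eq_dec as [->|Hne]; [exact Hd|].
  apply Rlt_trans with (/ INR (S p)); [apply h2; lia|apply HN1; lia].
Qed.

Lemma common_cluster_ex (x : nat -> nat -> R) (M : R) :
  (forall n k, Rabs (x n k) <= M) -> exists l, forall K, common_cluster x l K.
Proof.
  intros HM.
  assert (H0 : common_cluster x (fun _ => 0) 0).
  { intros e N _. exists N. split; [lia|]. intros; lia. }
  (* Stage [S K] alters only coordinate [K], so the limit of coordinate [k] is final from stage
     [S k] on. *)
  pose (build := fix build (K : nat) : {l | common_cluster x l K} :=
    match K with
    | O => exist _ (fun _ => 0) H0
    | S K => let (l, Hl) := build K in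
        let (v, Hv) := constructive_indefinite_description _
          (common_cluster_step x M l K HM Hl) in
        exist _ (fun k => if Nat.eq_dec k K then v else l k) Hv
    end).
  exists (fun k => proj1_sig (build (S k)) k). intros K.
  assert (agree : forall K k, (k < K)%nat ->
    proj1_sig (build (S k)) k = proj1_sig (build K) k).
  { clear K. intros K; induction K as [|K IH]; intros k Hk; [lia|].
    destruct (Nat.eq_dec k K) as [->|Hne]; [reflexivity|].
    rewrite IH by lia. simpl. destruct (build K) as [l Hl].
    destruct constructive_indefinite_description; simpl.
    destruct (Nat.eq_dec k K); [lia|reflexivity]. }
  intros e N He. destruct (proj2_sig (build K) e N He) as (n & Hn & H).
  exists n. split; [assumption|]. intros k Hk. rewrite (agree K k Hk). now apply H.
Qed.

Lemma finite_bound (phi : nat -> nat) (m : nat) :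
  exists K, forall i, (i <= m)%nat -> (phi i < K)%nat.
Proof.
  induction m as [|m [K HK]].
  - exists (S (phi 0%nat)). intros i Hi. replace i with 0%nat by lia. lia.
  - exists (max K (S (phi (S m)))). intros i Hi.
    destruct (Nat.eq_dec i (S m)) as [->|]; [lia|]. generalize (HK i ltac:(lia)). lia.
Qed.

Lemma equilipschitz_cluster (T M L : R) (u : nat -> R -> R) : 0 < T -> 0 < L ->
  (forall n t, 0 <= t <= T -> Rabs (u n t) <= M) ->
  (forall n s t, 0 <= s <= T -> 0 <= t <= T -> Rabs (u n t - u n s) <= L * Rabs (t - s)) ->
  exists w, cont w /\
    forall e N, 0 < e -> exists n, (N <= n)%nat /\
      forall t, 0 <= t <= T -> Rabs (u n t - w t) <= e.
Proof.
  intros HT HL HM Hlip.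
  assert (Hclamp : forall t, 0 <= clamp T t <= T) by (intros; apply clamp_bounds; lra).
  (* The points T i / (m + 1), enumerated by Cantor pairing; the clamp brings those with i > m + 1
     back into [0, T]. *)
  pose (grid := fun k => let (i, m) := of_nat k in clamp T (T * INR i / INR (S m))).
  destruct (common_cluster_ex (fun n k => u n (grid k)) M) as [l Hl].
  { intros n k. apply HM. unfold grid. destruct (of_nat k). apply Hclamp. }
  assert (Hn : forall K, exists n, (K <= n)%nat /\
    forall k, (k < K)%nat -> Rabs (u n (grid k) - l k) < / INR (S K)).
  { intros K. apply Hl. apply Rinv_0_lt_compat, lt_0_INR; lia. }
  pose (sel := fun K => proj1_sig (constructive_indefinite_description _ (Hn K))).
  assert (Hsel : forall K, (K <= sel K)%nat /\
    forall k, (k < K)%nat -> Rabs (u (sel K) (grid k) - l k) < / INR (S K)).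
  { intros K. unfold sel. now destruct constructive_indefinite_description. }
  assert (cauchy : forall e, 0 < e -> exists K0, forall K K', (K0 <= K)%nat -> (K0 <= K')%nat ->
    forall t, 0 <= t <= T -> Rabs (u (sel K) t - u (sel K') t) <= e).
  { intros e He.
    (* With this mesh, u varies by at most e/4 between [t] and the grid point on its left. Two such
       errors and two distances to the cluster value add up to e. *)
    destruct (archimed_INR (e / (4 * (L * T)))) as [m Hm].
    { apply Rdiv_lt_0_compat; [lra|]. nra. }
    specialize (Hm m (Nat.le_refl m)).
    destruct (archimed_INR (e / 4) ltac:(lra)) as [N HN].
    destruct (finite_bound (fun i => to_nat (i, m)) (S m)) as [K1 HK1].
    assert (Sm : 0 < INR (S m)) by (apply lt_0_INR; lia).
    exists (max N K1). intros K K' HK HK' t Ht.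
    destruct (nfloor_ex (t * INR (S m) / T)) as [i Hi].
    { apply Rmult_le_pos; [apply Rmult_le_pos; lra|left; apply Rinv_0_lt_compat; lra]. }
    set (p := T * INR i / INR (S m)).
    assert (Hp : 0 <= t - p <= T * / INR (S m)).
    { assert (e1 : t = (t * INR (S m) / T) * (T / INR (S m))) by (field; lra).
      assert (e2 : p = INR i * (T / INR (S m))) by (unfold p; field; lra).
      assert (0 < T / INR (S m)) by (apply Rdiv_lt_0_compat; lra).
      rewrite e1, e2. unfold Rdiv in *. split; nra. }
    assert (p0 : 0 <= p).
    { unfold p. apply Rmult_le_pos; [|left; apply Rinv_0_lt_compat; lra].
      apply Rmult_le_pos; [lra|apply pos_INR]. }
    assert (Hi' : (i <= S m)%nat).
    { apply INR_le. apply Rle_trans with (1 := proj1 Hi).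
      apply Rmult_le_reg_r with T; [lra|]. field_simplify; [|lra]. nra. }
    assert (gp : grid (to_nat (i, m)) = p).
    { unfold grid. rewrite cancel_of_to. apply clamp_id. fold p. lra. }
    assert (near : forall n, Rabs (u n t - u n p) <= e / 4).
    { intros n. eapply Rle_trans; [apply Hlip; lra|]. rewrite Rabs_pos_eq by lra.
      apply Rle_trans with (L * (T * (e / (4 * (L * T))))).
      - apply Rmult_le_compat_l; [lra|]. apply Rle_trans with (1 := proj2 Hp).
        apply Rmult_le_compat_l; lra.
      - right. field. lra. }
    assert (close : forall K, (max N K1 <= K)%nat ->
      Rabs (u (sel K) p - l (to_nat (i, m))) <= e / 4).
    { intros k Hk. rewrite <- gp. destruct (Hsel k) as [_ h].
      left. apply Rlt_trans with (/ INR (S k)).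
      - apply h. generalize (HK1 i Hi'). lia.
      - apply HN. lia. }
    generalize (near (sel K)) (near (sel K')) (close K HK) (close K' HK'); intros h1 h2 h3 h4.
    apply Rabs_le_between in h1, h2, h3, h4. apply Rabs_le. lra. }
  pose (w := fun t => real (Lim_seq (fun K => u (sel K) (clamp T t)))).
  assert (Hw : forall t, is_lim_seq (fun K => u (sel K) (clamp T t)) (w t)).
  { intros t. apply Lim_seq_correct'. apply ex_lim_seq_cauchy_corr. intros e.
    destruct (cauchy (e / 2) ltac:(generalize (cond_pos e); lra)) as [K0 H].
    exists K0. intros n m H1 H2. apply Rle_lt_trans with (e / 2).
    - apply H; auto.
    - generalize (cond_pos e); lra. }
  assert (conv : forall e, 0 < e -> exists K0, forall K, (K0 <= K)%nat ->
    forall t, Rabs (u (sel K) (clamp T t) - w t) <= e).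
  { intros e He. destruct (cauchy e He) as [K0 H]. exists K0. intros K HK t.
    assert (hl : is_lim_seq (fun K' => Rabs (u (sel K) (clamp T t) - u (sel K') (clamp T t)))
      (Rbar_abs (u (sel K) (clamp T t) - w t))).
    { apply is_lim_seq_abs. apply is_lim_seq_minus'; [apply is_lim_seq_const|apply Hw]. }
    apply (is_lim_seq_le_loc _ (fun _ => e) _ (Finite e)) in hl.
    - exact hl.
    - exists K0. intros K' HK'. now apply H.
    - apply is_lim_seq_const. }
  exists w. split.
  - apply cont_lipschitz with L; [assumption|]. intros s t.
    apply Rnot_lt_le. intros h.
    set (gap := Rabs (w t - w s) - L * Rabs (t - s)).
    destruct (conv (gap / 4) ltac:(unfold gap; lra)) as [K0 H].
    generalize (H K0 (Nat.le_refl _) t) (H K0 (Nat.le_refl _) s); intros h1 h2.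
    assert (h3 : Rabs (u (sel K0) (clamp T t) - u (sel K0) (clamp T s)) <= L * Rabs (t - s)).
    { eapply Rle_trans; [apply Hlip; apply Hclamp|]. apply Rmult_le_compat_l; [lra|].
      apply clamp_lipschitz. }
    assert (h4 : Rabs (w t - w s) <= L * Rabs (t - s) + gap / 2).
    { apply Rabs_le_between in h1, h2, h3. apply Rabs_le. lra. }
    unfold gap in h4; lra.
  - intros e N He. destruct (conv e He) as [K0 H].
    exists (sel (max N K0)). split.
    + generalize (proj1 (Hsel (max N K0))). lia.
    + intros t Ht. generalize (H (max N K0) ltac:(lia) t). now rewrite (clamp_id T t Ht).
Qed.

(** * The linear boundary value problem *)

Section LinearProblem.

Variables T eta alpha beta : R.
Hypothesis Heta : 0 < eta < T.
Hypothesis Halpha : 0 < alpha.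
Hypothesis Hbeta : 0 <= beta.

(** When the affine coefficients are expressed by u(eta), the condition at T, multiplied by 2 eta,
    equates [bvp_det] times u(eta) with a functional of the right-hand side. It is the common
    numerator of [Lambda1] and [Lambda2]. *)
Definition bvp_det : R :=
  (2 * T - alpha * eta ^ 2) - beta * (alpha * eta ^ 2 - 2 * eta + 2 * T).

Hypothesis Hdet : 0 < bvp_det.

(** The value of the solution at eta. It determines [lft] by the condition at 0 and then [slope]. *)
Definition mid (y : R -> R) : R :=
  (2 * eta * prim (prim y) T - (2 * T - alpha * eta ^ 2) * prim (prim y) eta
   - 2 * alpha * eta * prim (prim (prim y)) eta) / bvp_det.

Definition lft (y : R -> R) : R := beta * mid y.

Definition slope (y : R -> R) : R := (mid y * (1 - beta) + prim (prim y) eta) / eta.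

Definition sol (y : R -> R) (t : R) : R := lft y + slope y * t - prim (prim y) t.

(* The affine part of [sol y] takes the values [lft y] at 0 and [rgt y] at T. *)
Definition rgt (y : R -> R) : R := lft y + slope y * T.

(** The difference is [bvp_det] + 2 beta (T - eta). It is the last denominator in [gamma]. *)
Lemma alpha_eta_lt : alpha * (beta + 1) * eta ^ 2 < 2 * T.
Proof. unfold bvp_det in Hdet. nra. Qed.

Lemma is_derive_sol (y : R -> R) (t : R) : cont y ->
  is_derive (sol y) t (slope y - prim y t).
Proof.
  intros cy. unfold sol.
  apply (is_derive_minus (V := R_NormedModule) (fun t => lft y + slope y * t)).
  - auto_derive; [trivial|ring].
  - now apply is_derive_prim, cont_prim.
Qed.

Lemma cont_sol (y : R -> R) : cont y -> cont (sol y).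
Proof. intros cy. apply is_derive_cont with (1 := fun t => is_derive_sol y t cy). Qed.

Lemma Derive_sol (y : R -> R) : cont y -> Derive (sol y) = (fun t => slope y - prim y t).
Proof.
  intros cy. apply functional_extensionality; intros t.
  now apply is_derive_unique, is_derive_sol.
Qed.

Lemma is_derive_Derive_sol (y : R -> R) (t : R) : cont y ->
  is_derive (Derive (sol y)) t (- y t).
Proof.
  intros cy. rewrite Derive_sol by assumption.
  replace (- y t) with (minus 0 (y t)) by (unfold minus, plus, opp; simpl; ring).
  apply (is_derive_minus (V := R_NormedModule) (fun _ => slope y)).
  - apply (is_derive_const (V := R_NormedModule)).
  - now apply is_derive_prim.
Qed.

Lemma sol_0 (y : R -> R) : sol y 0 = lft y.
Proof. unfold sol. rewrite prim_0. ring. Qed.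

Lemma sol_eta (y : R -> R) : sol y eta = mid y.
Proof. unfold sol, slope, lft. field. lra. Qed.

Lemma RInt_sol (y : R -> R) : cont y ->
  RInt (sol y) 0 eta
  = lft y * eta + slope y * eta ^ 2 / 2 - prim (prim (prim y)) eta.
Proof.
  intros cy.
  replace (_ - _) with
    ((lft y * eta + slope y * eta ^ 2 / 2 - prim (prim (prim y)) eta)
     - (lft y * 0 + slope y * 0 ^ 2 / 2 - prim (prim (prim y)) 0))
    by (rewrite prim_0; field).
  apply (is_RInt_unique (V := R_CompleteNormedModule)).
  apply (is_RInt_derive (V := R_CompleteNormedModule)
    (fun t => lft y * t + slope y * t ^ 2 / 2 - prim (prim (prim y)) t)).
  - intros t _. unfold sol.
    apply (is_derive_minus (V := R_NormedModule) (fun t => lft y * t + slope y * t ^ 2 / 2)).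
    + auto_derive; [trivial|field].
    + now apply is_derive_prim, cont_prim, cont_prim.
  - intros t _. now apply cont_sol.
Qed.

Lemma sol_T (y : R -> R) : cont y -> sol y T = alpha * RInt (sol y) 0 eta.
Proof.
  intros cy. rewrite RInt_sol by assumption. unfold sol, slope, lft, mid.
  unfold bvp_det in *. field. lra.
Qed.

Lemma mid_comb (k l : R) (y z : R -> R) : cont y -> cont z ->
  mid (fun s => k * y s + l * z s) = k * mid y + l * mid z.
Proof.
  intros cy cz. unfold mid. rewrite !prim_comb by auto using cont_prim. field. lra.
Qed.

Lemma lft_comb (k l : R) (y z : R -> R) : cont y -> cont z ->
  lft (fun s => k * y s + l * z s) = k * lft y + l * lft z.
Proof. intros cy cz. unfold lft. rewrite mid_comb by assumption. ring. Qed.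

Lemma slope_comb (k l : R) (y z : R -> R) : cont y -> cont z ->
  slope (fun s => k * y s + l * z s) = k * slope y + l * slope z.
Proof.
  intros cy cz. unfold slope. rewrite mid_comb, !prim_comb by auto using cont_prim.
  field. lra.
Qed.

Lemma rgt_comb (k l : R) (y z : R -> R) : cont y -> cont z ->
  rgt (fun s => k * y s + l * z s) = k * rgt y + l * rgt z.
Proof.
  intros cy cz. unfold rgt. rewrite lft_comb, slope_comb by assumption. ring.
Qed.

Lemma sol_comb (k l : R) (y z : R -> R) (t : R) : cont y -> cont z ->
  sol (fun s => k * y s + l * z s) t = k * sol y t + l * sol z t.
Proof.
  intros cy cz. unfold sol. rewrite lft_comb, slope_comb, !prim_comb by auto using cont_prim.
  ring.
Qed.

(** Let A and B be the double primitive at T and eta. By [prim3_le] the terms in alpha are together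
    nonnegative, which leaves 2 eta A - 2 T B; Taylor's formula and B <= eta [prim y eta] give the
    integral. *)
Lemma mid_gain (y : R -> R) : cont y -> (forall s, 0 <= y s) ->
  2 * eta * RInt (fun s => (T - s) * y s) eta T <= bvp_det * mid y.
Proof.
  intros cy y0. rewrite prim2_taylor by assumption.
  replace (bvp_det * mid y) with
    (2 * eta * prim (prim y) T - (2 * T - alpha * eta ^ 2) * prim (prim y) eta
     - 2 * alpha * eta * prim (prim (prim y)) eta) by (unfold mid; field; lra).
  generalize (prim3_le y eta cy y0 ltac:(lra)); intros h1.
  destruct (prim2_slope y 0 eta cy y0) as [_ h2]; [lra|].
  rewrite prim_0 in h2.
  assert (alpha * eta * (2 * prim (prim (prim y)) eta)
    <= alpha * eta * (eta * prim (prim y) eta)).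
  { apply Rmult_le_compat_l; [nra|lra]. }
  assert ((T - eta) * prim (prim y) eta <= (T - eta) * (eta * prim y eta)).
  { apply Rmult_le_compat_l; lra. }
  nra.
Qed.

Lemma mid_nonneg (y : R -> R) : cont y -> (forall s, 0 <= y s) -> 0 <= mid y.
Proof.
  intros cy y0. generalize (mid_gain y cy y0); intros h.
  assert (0 <= RInt (fun s => (T - s) * y s) eta T).
  { apply RInt_ge_0; [lra| |].
    - apply cont_ex_RInt. intros s.
      apply (continuous_mult (K := R_AbsRing) (fun s => T - s)); [|apply cy].
      apply (continuous_minus (V := R_NormedModule)); [apply continuous_const|apply continuous_id].
    - intros s Hs. apply Rmult_le_pos; [lra|auto]. }
  apply Rmult_le_reg_l with bvp_det; [assumption|]. rewrite Rmult_0_r.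
  apply Rle_trans with (2 := h). nra.
Qed.

Lemma lft_nonneg (y : R -> R) : cont y -> (forall s, 0 <= y s) -> 0 <= lft y.
Proof. intros cy y0. apply Rmult_le_pos; [lra|now apply mid_nonneg]. Qed.

Lemma sol_concave (y : R -> R) (s t r : R) : cont y -> (forall s, 0 <= y s) ->
  s <= t <= r -> (sol y r - sol y t) * (t - s) <= (sol y t - sol y s) * (r - t).
Proof.
  intros cy y0 H. unfold sol.
  destruct (prim2_slope y s t cy y0) as [_ h1]; [lra|].
  destruct (prim2_slope y t r cy y0) as [h2 _]; [lra|].
  assert ((prim (prim y) t - prim (prim y) s) * (r - t)
    <= (t - s) * prim y t * (r - t)) by (apply Rmult_le_compat_r; lra).
  assert ((r - t) * prim y t * (t - s)
    <= (prim (prim y) r - prim (prim y) t) * (t - s)) by (apply Rmult_le_compat_r; lra).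
  lra.
Qed.

(** By concavity the integral over [0, eta] is at least the area of the trapezoid with sides beta
    u(eta) and u(eta). This is the origin of alpha (beta + 1) eta / 2 in [gamma]. *)
Lemma sol_T_eta (y : R -> R) : cont y -> (forall s, 0 <= y s) ->
  alpha * (beta + 1) * eta / 2 * mid y <= sol y T.
Proof.
  intros cy y0. rewrite sol_T, RInt_sol by assumption.
  generalize (prim3_le y eta cy y0 ltac:(lra)); intros h.
  replace (slope y * eta ^ 2) with (eta * (mid y * (1 - beta) + prim (prim y) eta))
    by (unfold slope; field; lra).
  unfold lft.
  replace (alpha * (beta + 1) * eta / 2 * mid y)
    with (alpha * ((beta + 1) * eta / 2 * mid y)) by field.
  apply Rmult_le_compat_l; [lra|]. lra.
Qed.

Lemma sol_nonneg (y : R -> R) (t : R) : cont y -> (forall s, 0 <= y s) ->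
  0 <= t <= T -> 0 <= sol y t.
Proof.
  intros cy y0 Ht.
  generalize (mid_nonneg y cy y0) (lft_nonneg y cy y0) (sol_T_eta y cy y0); intros hm hl hT.
  assert (0 <= alpha * (beta + 1) * eta / 2 * mid y).
  { apply Rmult_le_pos; [|assumption].
    assert (0 <= alpha * (beta + 1)) by nra. nra. }
  generalize (sol_concave y 0 t T cy y0 Ht); rewrite sol_0; intros h.
  apply Rmult_le_reg_r with T; [lra|]. nra.
Qed.

Lemma rgt_eq (y : R -> R) : rgt y = sol y T + prim (prim y) T.
Proof. unfold rgt, sol. ring. Qed.

Lemma rgt_ge (y : R -> R) : cont y -> (forall s, 0 <= y s) -> prim (prim y) T <= rgt y.
Proof.
  intros cy y0. rewrite rgt_eq. generalize (sol_nonneg y T cy y0 ltac:(lra)). lra.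
Qed.

Lemma rgt_nonneg (y : R -> R) : cont y -> (forall s, 0 <= y s) -> 0 <= rgt y.
Proof.
  intros cy y0. generalize (rgt_ge y cy y0) (prim2_nonneg y T cy y0 ltac:(lra)). lra.
Qed.

Lemma positive_functional_le (Phi : (R -> R) -> R) :
  (forall k l y z, cont y -> cont z ->
     Phi (fun s => k * y s + l * z s) = k * Phi y + l * Phi z) ->
  (forall y, cont y -> (forall s, 0 <= y s) -> 0 <= Phi y) ->
  forall k l y z, cont y -> cont z -> (forall s, k * y s <= l * z s) ->
  k * Phi y <= l * Phi z.
Proof.
  intros lin pos k l y z cy cz H.
  assert (h : 0 <= Phi (fun s => l * z s + - k * y s)).
  { apply pos; [now apply cont_comb|]. intros s. generalize (H s); lra. }
  rewrite lin in h by assumption. lra.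
Qed.

Definition mid_le := positive_functional_le mid mid_comb mid_nonneg.
Definition lft_le := positive_functional_le lft lft_comb lft_nonneg.
Definition rgt_le := positive_functional_le rgt rgt_comb rgt_nonneg.

Lemma sol_le (k l t : R) (y z : R -> R) : 0 <= t <= T -> cont y -> cont z ->
  (forall s, k * y s <= l * z s) -> k * sol y t <= l * sol z t.
Proof.
  intros Ht. apply (positive_functional_le (fun y => sol y t)).
  - intros. now apply sol_comb.
  - intros. now apply sol_nonneg.
Qed.

(** Strictness matters: for beta = 0 the constant on the right is exactly T times the bracket in
    [Lambda1], so no slack is left elsewhere when M1 = Lambda1. *)
Lemma sol_lt (y : R -> R) (M t : R) : cont y -> (forall s, 0 <= y s) ->
  0 < M -> prim (prim y) T <= M -> 0 <= t <= T ->
  bvp_det * sol y t < (2 * T + 2 * beta * eta + alpha * beta * T ^ 2) * M.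
Proof.
  intros cy y0 HM HA Ht.
  set (A := prim (prim y) T) in *. set (V := prim (prim y) t).
  assert (key : bvp_det * sol y t <=
    (2 * t + 2 * beta * eta + alpha * beta * T ^ 2) * A - bvp_det * V).
  { generalize (prim3_le y eta cy y0 ltac:(lra)).
    generalize (prim2_nonneg y eta cy y0 ltac:(lra)).
    destruct (prim2_slope y eta T cy y0) as [h _]; [lra|]. revert h.
    assert (0 <= prim y eta).
    { apply prim_nonneg with eta; auto; lra. }
    assert (0 <= prim (prim (prim y)) eta).
    { apply prim_nonneg with eta; [now apply cont_prim, cont_prim| |lra].
      intros s Hs. apply prim2_nonneg; auto; lra. }
    fold A. unfold sol, slope, lft, mid. fold A. fold V.
    set (B := prim (prim y) eta). set (W := prim (prim (prim y)) eta) in *.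
    set (P := prim y eta) in *.
    intros h1 h2 h3.
    assert (BA : B <= A) by nra.
    apply Rle_trans with (2 * t * A + 2 * beta * eta * A + alpha * beta * (T * (eta * B))
      - bvp_det * V).
    2:{ assert (T * (eta * B) <= T * (T * A)).
        { apply Rmult_le_compat_l; [lra|]. apply Rmult_le_compat; lra. }
        assert (alpha * beta * (T * (eta * B)) <= alpha * beta * (T * (T * A))).
        { apply Rmult_le_compat_l; [apply Rmult_le_pos; lra|lra]. } nra. }
    (* Of these terms 2 t A, 2 beta eta A and - bvp_det V are kept, and 2 alpha beta t W is bounded
       through 2 W <= eta B. The rest is nonpositive once - 2 beta t A is paired with 2 beta t B. *)
    assert (e : bvp_det * (beta * ((2 * eta * A - (2 * T - alpha * eta ^ 2) * B - 2 * alpha * eta * W) / bvp_det)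
       + ((2 * eta * A - (2 * T - alpha * eta ^ 2) * B - 2 * alpha * eta * W) / bvp_det * (1 - beta) + B) / eta * t - V)
      = 2 * (1 - beta) * t * A + 2 * beta * eta * A - beta * (2 * T - alpha * eta ^ 2) * B
        + 2 * beta * t * B - 2 * alpha * beta * eta * t * B
        - 2 * alpha * W * ((1 - beta) * t + beta * eta) - bvp_det * V).
    { unfold bvp_det in *. field. lra. }
    rewrite e.
    assert (0 <= beta * t * (A - B)) by (repeat apply Rmult_le_pos; lra).
    assert (0 <= beta * (2 * T - alpha * eta ^ 2) * B).
    { generalize alpha_eta_lt; intros. apply Rmult_le_pos; [|lra]. apply Rmult_le_pos; nra. }
    assert (0 <= alpha * beta * eta * t * B) by (repeat apply Rmult_le_pos; lra).
    assert (0 <= alpha * W * t) by (repeat apply Rmult_le_pos; lra).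
    assert (0 <= alpha * W * beta * eta) by (repeat apply Rmult_le_pos; lra).
    assert (alpha * beta * (t * (2 * W)) <= alpha * beta * (T * (eta * B))).
    { apply Rmult_le_compat_l; [apply Rmult_le_pos; lra|]. apply Rmult_le_compat; lra. }
    lra. }
  apply Rle_lt_trans with (1 := key).
  assert (A0 : 0 <= A) by (apply prim2_nonneg; auto; lra).
  assert (V0 : 0 <= V) by (apply prim2_nonneg; auto; lra).
  assert (0 <= bvp_det * V) by (apply Rmult_le_pos; lra).
  assert (k0 : 0 <= 2 * beta * eta + alpha * beta * T ^ 2).
  { assert (0 <= alpha * beta * T ^ 2) by (repeat apply Rmult_le_pos; try lra; nra). nra. }
  (* For t < T strictness comes from 2 t < 2 T, for t = T from the term - bvp_det A, and if A = 0
     from M > 0. *)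
  destruct (Rle_lt_or_eq_dec t T (proj2 Ht)) as [HtT| ->].
  - apply Rle_lt_trans with ((2 * t + 2 * beta * eta + alpha * beta * T ^ 2) * A); [lra|].
    apply Rle_lt_trans with ((2 * t + 2 * beta * eta + alpha * beta * T ^ 2) * M); [|nra].
    apply Rmult_le_compat_l; lra.
  - change V with A. destruct (Rle_lt_or_eq_dec 0 A A0) as [h|h].
    + assert (0 < bvp_det * A) by (apply Rmult_lt_0_compat; lra).
      apply Rlt_le_trans with ((2 * T + 2 * beta * eta + alpha * beta * T ^ 2) * A); [lra|].
      apply Rmult_le_compat_l; lra.
    + rewrite <- h. nra.
Qed.

(** * The constant gamma and the cone inequality *)

Notation gam := (gamma T eta alpha beta).

Lemma gamma_pos : 0 < gam.
Proof.
  generalize alpha_eta_lt; intros.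
  assert (0 < alpha * (beta + 1)) by nra.
  unfold gamma. repeat apply Rmin_pos; apply Rdiv_lt_0_compat; try lra;
    repeat apply Rmult_lt_0_compat; try lra; nra.
Qed.

Lemma gamma_le1 : gam <= eta / T.
Proof. apply Rmin_l. Qed.

Lemma gamma_le2 : gam <= alpha * (beta + 1) * eta ^ 2 / (2 * T).
Proof. eapply Rle_trans; [apply Rmin_r|apply Rmin_l]. Qed.

Lemma gamma_le3 : gam <= alpha * (beta + 1) * eta * (T - eta)
          / (2 * T - alpha * (beta + 1) * eta ^ 2).
Proof. eapply Rle_trans; [apply Rmin_r|apply Rmin_r]. Qed.

Lemma gamma_lt_1 : gam < 1.
Proof.
  apply Rle_lt_trans with (1 := gamma_le1).
  apply Rmult_lt_reg_r with T; [lra|]. field_simplify; lra.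
Qed.

(** A concave function on [eta, T] is at least the smaller of its end values, so these are compared
    with [sol y x]. Points [x] right of eta lead to the first two terms of [gamma], points left of
    it to the third. *)
Lemma sol_cone (y : R -> R) (s x : R) : cont y -> (forall s, 0 <= y s) ->
  eta <= s <= T -> 0 <= x <= T -> gam * sol y x <= sol y s.
Proof.
  intros cy y0 Hs Hx.
  set (w := sol y eta). set (v := sol y T). set (k := alpha * (beta + 1) * eta / 2).
  assert (Hk : 0 < k).
  { unfold k. assert (0 < alpha * (beta + 1)) by nra. nra. }
  assert (HkT : k * eta < T) by (generalize alpha_eta_lt; unfold k; nra).
  assert (Hkw : k * w <= v).
  { unfold w. rewrite sol_eta. now apply sol_T_eta. }
  assert (w0 : 0 <= w) by (apply sol_nonneg; auto; lra).
  assert (v0 : 0 <= v) by (apply sol_nonneg; auto; lra).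
  assert (x0 : 0 <= sol y x) by (apply sol_nonneg; auto; lra).
  generalize gamma_pos gamma_lt_1; intros g0 g1.
  assert (Hmin : gam * sol y x <= w /\ gam * sol y x <= v).
  { destruct (Rle_dec x eta) as [hx|hx].
    - generalize (sol_concave y x eta T cy y0 ltac:(lra)); fold w v; intros h.
      destruct (Rle_dec w v) as [hw|hw].
      + assert (sol y x <= w) by nra. nra.
      (* The line through (eta, w) and (T, v) is decreasing here and lies above the solution left of
         eta, so its value at 0 bounds [sol y x]. With k w <= v this yields the third term of
         [gamma]. *)
      + assert (h2 : sol y x * (T - eta) <= w * T - v * eta) by nra.
        assert (h3 : k * (sol y x * (T - eta)) <= v * (T - k * eta)) by nra.
        assert (h4 : gam * (T - k * eta) <= k * (T - eta)).
        { generalize gamma_le3; intros h4.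
          apply Rmult_le_compat_r with (r := T - k * eta) in h4; [|lra].
          apply Rle_trans with (1 := h4). right. unfold k. field.
          generalize alpha_eta_lt; lra. }
        assert (gam * sol y x <= v); [|lra].
        apply Rmult_le_reg_r with (T - k * eta); [lra|].
        apply Rle_trans with (k * (sol y x * (T - eta))); [|assumption].
        replace (gam * sol y x * (T - k * eta)) with (sol y x * (gam * (T - k * eta))) by ring.
        replace (k * (sol y x * (T - eta))) with (sol y x * (k * (T - eta))) by ring.
        now apply Rmult_le_compat_l.
    (* The value at 0 being nonnegative, concavity gives eta u(x) <= T u(eta); [Hkw] carries the
       bound over to T. *)
    - generalize (sol_concave y 0 eta x cy y0 ltac:(lra)); fold w.
      rewrite sol_0; intros h. generalize (lft_nonneg y cy y0); intros l0.
      assert (h2 : eta * sol y x <= T * w) by nra.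
      assert (h3 : eta / T * sol y x <= w).
      { apply Rmult_le_reg_l with T; [lra|].
        replace (T * (eta / T * sol y x)) with (eta * sol y x) by (field; lra). assumption. }
      generalize gamma_le1 gamma_le2; intros g2 g3. split.
      + apply Rle_trans with (2 := h3). now apply Rmult_le_compat_r.
      + apply Rle_trans with (k * (eta / T * sol y x)).
        * apply Rle_trans with (alpha * (beta + 1) * eta ^ 2 / (2 * T) * sol y x).
          -- now apply Rmult_le_compat_r.
          -- right. unfold k. field. lra.
        * apply Rle_trans with (2 := Hkw). apply Rmult_le_compat_l; lra. }
  generalize (sol_concave y eta s T cy y0 Hs); fold w v; intros h.
  apply Rmult_le_reg_r with (T - eta); [lra|]. nra.
Qed.

(** The constant depends on [y] only through [k], so solutions with uniformly bounded forcing are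
    equi-Lipschitz. *)
Lemma sol_lipschitz (a y : R -> R) (k s t : R) :
  cont a -> cont y -> (forall s, 0 <= y s <= k * a s) ->
  0 <= s <= T -> 0 <= t <= T ->
  Rabs (sol y t - sol y s) <= k * ((lft a + rgt a) / T + prim a T) * Rabs (t - s).
Proof.
  intros ca cy H Hs Ht.
  destruct (MVT_gen (sol y) s t (fun t => slope y - prim y t)) as (c & Hc & ->).
  - intros; now apply is_derive_sol.
  - intros x _. apply continuity_pt_filterlim. now apply cont_sol.
  - rewrite Rabs_mult. apply Rmult_le_compat_r; [apply Rabs_pos|].
    assert (Hc' : 0 <= c <= T).
    { revert Hc. apply Rmin_case_strong; apply Rmax_case_strong; lra. }
    assert (hl : 1 * lft y <= k * lft a) by (apply lft_le; auto; intros r; generalize (H r); lra).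
    assert (hr : 1 * rgt y <= k * rgt a) by (apply rgt_le; auto; intros r; generalize (H r); lra).
    assert (l0 : 0 <= lft y) by (apply lft_nonneg; auto; intros r; apply H).
    assert (r0 : 0 <= rgt y) by (apply rgt_nonneg; auto; intros r; apply H).
    assert (p0 : 0 <= prim y c) by (apply prim_nonneg with c; auto; [intros; apply H|lra]).
    assert (p1 : prim y c <= prim y T) by (apply prim_mono; auto; [intros; apply H|lra]).
    assert (p2 : prim y T <= k * prim a T).
    { replace (k * prim a T) with (prim (fun s => k * a s + 0 * a s) T)
        by (rewrite prim_comb by assumption; ring).
      apply prim_le with T; auto using cont_comb; [|lra].
      intros r _. generalize (H r); lra. }
    assert (es : slope y = (rgt y - lft y) / T) by (unfold rgt; field; lra).
    assert (hs : Rabs (slope y) <= k * ((lft a + rgt a) / T)).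
    { rewrite es. unfold Rdiv. rewrite <- Rmult_assoc, Rabs_mult.
      rewrite (Rabs_pos_eq (/ T)) by (left; apply Rinv_0_lt_compat; lra).
      apply Rmult_le_compat_r; [left; apply Rinv_0_lt_compat; lra|].
      apply Rabs_le. lra. }
    apply Rabs_le_between in hs. apply Rabs_le. lra.
Qed.

Lemma sol_close : exists C, 0 < C /\
  forall y z d, cont y -> cont z -> (forall s, 0 <= s <= T -> Rabs (y s - z s) <= d) ->
  Rabs (lft y - lft z) <= C * d /\ Rabs (rgt y - rgt z) <= C * d /\
  forall t, 0 <= t <= T -> Rabs (sol y t - sol z t) <= C * d.
Proof.
  set (Cm := (2 * eta * (T * T) + (2 * T - alpha * eta ^ 2) * (T * T)
    + 2 * alpha * eta * (T * (T * T))) / bvp_det).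
  set (Cs := (Cm * (1 + beta) + T * T) / eta).
  assert (Hae : alpha * eta ^ 2 <= 2 * T) by (generalize alpha_eta_lt; nra).
  assert (TT : 0 < T * T) by nra.
  assert (TTT : 0 < T * (T * T)) by nra.
  assert (Cm0 : 0 < Cm).
  { unfold Cm. apply Rdiv_lt_0_compat; [|assumption].
    assert (0 < 2 * eta * (T * T)) by nra.
    assert (0 <= (2 * T - alpha * eta ^ 2) * (T * T)) by (apply Rmult_le_pos; lra).
    assert (0 < 2 * alpha * eta) by nra.
    assert (0 <= 2 * alpha * eta * (T * (T * T))) by (apply Rmult_le_pos; lra). lra. }
  assert (Cs0 : 0 < Cs) by (unfold Cs; apply Rdiv_lt_0_compat; nra).
  assert (0 <= Cm * beta) by nra.
  assert (0 < Cs * T) by nra.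
  exists (Cm + Cm * beta + Cs * T + T * T). split; [lra|].
  intros y z d cy cz H1.
  assert (d0 : 0 <= d) by (eapply Rle_trans; [apply Rabs_pos|apply (H1 0); lra]).
  assert (H2 : forall t, 0 <= t <= T -> Rabs (prim (prim y) t - prim (prim z) t) <= T * T * d).
  { intros t Ht. rewrite Rmult_assoc. apply prim_close; auto using cont_prim.
    intros s Hs. now apply prim_close. }
  assert (H3 : Rabs (prim (prim (prim y)) eta - prim (prim (prim z)) eta) <= T * (T * T * d)).
  { apply prim_close; auto using cont_prim. lra. }
  assert (Hm : Rabs (mid y - mid z) <= Cm * d).
  { generalize (H2 T ltac:(lra)) (H2 eta ltac:(lra)); intros h1 h2.
    unfold mid.
    set (A := prim (prim y) T) in *. set (A' := prim (prim z) T) in *.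
    set (B := prim (prim y) eta) in *. set (B' := prim (prim z) eta) in *.
    set (W := prim (prim (prim y)) eta) in *. set (W' := prim (prim (prim z)) eta) in *.
    replace (_ - _) with ((2 * eta * (A - A') - (2 * T - alpha * eta ^ 2) * (B - B')
      - 2 * alpha * eta * (W - W')) * / bvp_det) by (field; lra).
    rewrite Rabs_mult, (Rabs_pos_eq (/ bvp_det)) by (left; apply Rinv_0_lt_compat; lra).
    replace (Cm * d) with ((2 * eta * (T * T * d) + (2 * T - alpha * eta ^ 2) * (T * T * d)
      + 2 * alpha * eta * (T * (T * T * d))) * / bvp_det) by (unfold Cm; field; lra).
    apply Rmult_le_compat_r; [left; apply Rinv_0_lt_compat; lra|].
    apply Rabs_le_between in h1, h2, H3.
    assert (0 < 2 * alpha * eta) by nra.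
    generalize (Rmult_le_compat_l (2 * eta) _ _ ltac:(lra) (proj1 h1))
      (Rmult_le_compat_l (2 * eta) _ _ ltac:(lra) (proj2 h1))
      (Rmult_le_compat_l (2 * T - alpha * eta ^ 2) _ _ ltac:(lra) (proj1 h2))
      (Rmult_le_compat_l (2 * T - alpha * eta ^ 2) _ _ ltac:(lra) (proj2 h2))
      (Rmult_le_compat_l (2 * alpha * eta) _ _ ltac:(lra) (proj1 H3))
      (Rmult_le_compat_l (2 * alpha * eta) _ _ ltac:(lra) (proj2 H3)); intros.
    apply Rabs_le; lra. }
  assert (Hl : Rabs (lft y - lft z) <= Cm * beta * d).
  { unfold lft. replace (_ - _) with (beta * (mid y - mid z)) by ring.
    rewrite Rabs_mult, (Rabs_pos_eq beta) by lra.
    generalize (Rmult_le_compat_l beta _ _ Hbeta Hm). lra. }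
  assert (Hs : Rabs (slope y - slope z) <= Cs * d).
  { generalize (H2 eta ltac:(lra)); intros h2. unfold slope.
    set (B := prim (prim y) eta) in *. set (B' := prim (prim z) eta) in *.
    replace (_ - _) with (((mid y - mid z) - beta * (mid y - mid z) + (B - B')) * / eta)
      by (field; lra).
    rewrite Rabs_mult, (Rabs_pos_eq (/ eta)) by (left; apply Rinv_0_lt_compat; lra).
    replace (Cs * d) with ((Cm * d + beta * (Cm * d) + T * T * d) * / eta)
      by (unfold Cs; field; lra).
    apply Rmult_le_compat_r; [left; apply Rinv_0_lt_compat; lra|].
    apply Rabs_le_between in h2, Hm.
    generalize (Rmult_le_compat_l beta _ _ Hbeta (proj1 Hm))
      (Rmult_le_compat_l beta _ _ Hbeta (proj2 Hm)); intros.
    apply Rabs_le; lra. }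
  assert (Ha : forall t, 0 <= t <= T ->
    Rabs ((lft y + slope y * t) - (lft z + slope z * t)) <= (Cm * beta + Cs * T) * d).
  { intros t Ht. replace (_ - _) with ((lft y - lft z) + t * (slope y - slope z)) by ring.
    eapply Rle_trans; [apply Rabs_triang|]. rewrite Rabs_mult, (Rabs_pos_eq t) by lra.
    assert (t * Rabs (slope y - slope z) <= T * (Cs * d)).
    { apply Rmult_le_compat; try lra. apply Rabs_pos. }
    lra. }
  assert (0 <= Cm * d) by nra. assert (0 <= Cm * beta * d) by nra.
  assert (0 <= Cs * T * d) by nra. assert (0 <= T * T * d) by nra.
  split; [lra|split].
  - generalize (Ha T ltac:(lra)); unfold rgt; lra.
  - intros t Ht. generalize (Ha t Ht) (H2 t Ht); intros h1 h2. unfold sol.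
    apply Rabs_le_between in h1, h2. apply Rabs_le; lra.
Qed.

(** * Shooting in polar coordinates *)

Section PolarFixedPoint.

Variables (a g : R -> R) (delta : R).
Hypothesis Hdelta : 0 < delta.
Hypothesis ca : cont a.
Hypothesis cg : cont g.
Hypothesis a0 : forall t, 0 <= a t.
Hypothesis g0 : forall t, 0 <= g t.

Variables (mu : R -> R) (X : R -> R -> R).
Hypothesis cmu : cont mu.
Hypothesis mu0 : forall r, 0 <= mu r.
Hypothesis cX : forall m r, continuity_2d_pt X m r.

(** The affine function with values r th at 0 and r (1 - th) at T: polar coordinates for the l1
    norm. *)
Definition line (th r t : R) : R := r * th * (1 - t / T) + r * (1 - th) * (t / T).

Lemma cont_line (th r : R) : cont (line th r).
Proof.
  apply is_derive_cont with (fun _ => (r * (1 - th) - r * th) / T).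
  intros t. unfold line. auto_derive; [trivial|]. field. lra.
Qed.

Lemma forcing_nonneg (u : R -> R) (c s : R) : 0 <= c -> 0 <= forcing T a g delta u c s.
Proof. intros Hc. apply Rmult_le_pos; [apply a0|]. generalize (g0 (u (clamp T (s - delta)))); lra. Qed.

Let shoot (N : nat) (th r : R) : R -> R := delayed T a g delta N (line th r) (mu r).
Let load (N : nat) (th r : R) : R -> R := forcing T a g delta (shoot N th r) (mu r).

Lemma cont_shoot (N : nat) (th r : R) : cont (shoot N th r).
Proof. apply cont_delayed; auto using cont_line. Qed.

Lemma cont_load (N : nat) (th r : R) : cont (load N th r).
Proof. apply cont_forcing; auto using cont_shoot. Qed.

Lemma shoot_load_close (N : nat) (th r e : R) : 0 < e ->
  locally_2d (fun th' r' => forall s, 0 <= s <= T ->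
    Rabs (shoot N th' r' s - shoot N th r s) <= e /\
    Rabs (load N th' r' s - load N th r s) <= e) th r.
Proof.
  intros He.
  destruct (forcing_close T a g delta ltac:(lra) ca cg (shoot N th r) (mu r) e (cont_shoot N th r) He)
    as (d1 & d10 & H1).
  destruct (delayed_close T a g delta ltac:(lra) ca cg N (line th r) (mu r) (Rmin d1 e)
    (cont_line th r) (Rmin_pos _ _ d10 He)) as (d2 & d20 & H2).
  set (d := Rmin d1 d2). assert (d0 : 0 < d) by now apply Rmin_pos.
  assert (dh : 0 < d / 2) by lra.
  assert (c1 : continuity_2d_pt (fun th r => r * th) th r).
  { apply continuity_2d_pt_mult; [apply continuity_2d_pt_id2|apply continuity_2d_pt_id1]. }
  assert (c2 : continuity_2d_pt (fun th r => r * (1 - th)) th r).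
  { apply continuity_2d_pt_mult; [apply continuity_2d_pt_id2|].
    apply continuity_2d_pt_minus; [apply continuity_2d_pt_const|apply continuity_2d_pt_id1]. }
  assert (c3 : continuity_2d_pt (fun _ r => mu r) th r).
  { apply (continuity_1d_2d_pt_comp mu (fun _ r => r)); [|apply continuity_2d_pt_id2].
    apply continuity_pt_filterlim, cmu. }
  generalize (locally_2d_and _ _ _ _ (c1 (mkposreal _ dh))
    (locally_2d_and _ _ _ _ (c2 (mkposreal _ dh)) (c3 (mkposreal _ dh)))).
  apply locally_2d_impl, locally_2d_forall. simpl.
  intros th' r' (h1 & h2 & h3).
  generalize (Rmin_l d1 d2) (Rmin_r d1 d2) (Rmin_l d1 e) (Rmin_r d1 e); fold d; intros m1 m2 m3 m4.
  assert (hl : forall t, 0 <= t <= T -> Rabs (line th' r' t - line th r t) <= d2).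
  { intros t Ht.
    assert (ht : 0 <= t / T <= 1).
    { split; [apply Rmult_le_pos; [lra|left; apply Rinv_0_lt_compat; lra]|].
      apply Rmult_le_reg_r with T; [lra|]. field_simplify; lra. }
    unfold line.
    replace (_ - _) with ((r' * th' - r * th) * (1 - t / T)
      + (r' * (1 - th') - r * (1 - th)) * (t / T)) by ring.
    eapply Rle_trans; [apply Rabs_triang|]. rewrite !Rabs_mult.
    rewrite (Rabs_pos_eq (1 - t / T)), (Rabs_pos_eq (t / T)) by lra.
    generalize (Rabs_pos (r' * th' - r * th)) (Rabs_pos (r' * (1 - th') - r * (1 - th))).
    intros. nra. }
  assert (hs : forall t, 0 <= t <= T -> Rabs (shoot N th' r' t - shoot N th r t) <= Rmin d1 e).
  { apply H2; [apply cont_line|exact hl|lra]. }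
  intros t Ht. split; [generalize (hs t Ht); lra|].
  apply H1; [|lra|assumption]. intros s Hs. generalize (hs s Hs); lra.
Qed.

Lemma continuity_load_functional (N : nat) (Phi : (R -> R) -> R) (C : R) : 0 < C ->
  (forall y z d, cont y -> cont z -> (forall s, 0 <= s <= T -> Rabs (y s - z s) <= d) ->
     Rabs (Phi y - Phi z) <= C * d) ->
  forall th r, continuity_2d_pt (fun th r => Phi (load N th r)) th r.
Proof.
  intros C0 H th r e.
  assert (He : 0 < e / (2 * C)) by (apply Rdiv_lt_0_compat; [apply cond_pos|lra]).
  generalize (shoot_load_close N th r _ He). apply locally_2d_impl, locally_2d_forall.
  intros th' r' h.
  apply Rle_lt_trans with (C * (e / (2 * C))).
  - apply H; try apply cont_load. intros s Hs. now apply h.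
  - replace (C * (e / (2 * C))) with (e / 2) by (field; lra). generalize (cond_pos e); lra.
Qed.

Lemma continuity_sup_shoot (N : nat) (th r : R) :
  continuity_2d_pt (fun th r => sup_pos T (shoot N th r)) th r.
Proof.
  intros e. assert (He : 0 < e / 2) by (generalize (cond_pos e); lra).
  generalize (shoot_load_close N th r _ He). apply locally_2d_impl, locally_2d_forall.
  intros th' r' h.
  apply Rle_lt_trans with (e / 2); [|generalize (cond_pos e); lra].
  apply sup_pos_close; try apply cont_shoot; [lra|]. intros s Hs. now apply h.
Qed.

Definition delay_solution (th r : R) (u : R -> R) : Prop :=
  cont u /\ forall t, 0 <= t <= T ->
    u t = line th r t - prim (prim (forcing T a g delta u (mu r))) t.

Definition balance (r : R) (u : R -> R) : R :=
  X (sup_pos T u) r *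
    (lft (forcing T a g delta u (mu r))
     + rgt (forcing T a g delta u (mu r))) - r.

(* The affine part of [u] is the pair (r th, r (1 - th)). One equation asks
   that it be proportional to the affine part of [sol (forcing u)], the other
   fixes the ratio; on the edges th = 0, 1 the first one has a sign by
   positivity of [lft] and [rgt]. *)
Lemma polar_fixed_point (r0 r1 : R) : r0 <= r1 ->
  ((forall th u, 0 <= th <= 1 -> delay_solution th r0 u -> 0 <= balance r0 u) /\
   (forall th u, 0 <= th <= 1 -> delay_solution th r1 u -> balance r1 u <= 0) \/
   (forall th u, 0 <= th <= 1 -> delay_solution th r0 u -> balance r0 u <= 0) /\
   (forall th u, 0 <= th <= 1 -> delay_solution th r1 u -> 0 <= balance r1 u)) ->
  exists th r u, 0 <= th <= 1 /\ r0 <= r <= r1 /\ delay_solution th r u /\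
    X (sup_pos T u) r * lft (forcing T a g delta u (mu r)) = r * th /\
    X (sup_pos T u) r * rgt (forcing T a g delta u (mu r)) = r * (1 - th).
Proof.
  intros Hr Hedges.
  destruct (sol_close) as (C & C0 & HC).
  (* [N] steps of length delta cover [0, T], so [shoot N] solves the delayed equation exactly. *)
  destruct (INR_unbounded (T / delta)) as [N HN].
  assert (HN' : T <= INR N * delta).
  { apply Rmult_lt_compat_r with (r := delta) in HN; [|assumption].
    replace (T / delta * delta) with T in HN by (field; lra). lra. }
  assert (Hsol : forall th r, delay_solution th r (shoot N th r)).
  { intros th r. split; [apply cont_shoot|]. intros t Ht.
    assert (Ht' : 0 <= t <= INR N * delta) by lra.
    symmetry. exact (delayed_stable T a g delta Hdelta N (line th r) (mu r) t Ht'). }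
  set (lf := fun th r => lft (load N th r)).
  set (rg := fun th r => rgt (load N th r)).
  assert (clf : forall th r, continuity_2d_pt lf th r).
  { apply continuity_load_functional with C; [assumption|]. intros; now apply HC. }
  assert (crg : forall th r, continuity_2d_pt rg th r).
  { apply continuity_load_functional with C; [assumption|]. intros; now apply HC. }
  set (F := fun th r => (1 - th) * lf th r - th * rg th r).
  set (H := fun th r => X (sup_pos T (shoot N th r)) r * (lf th r + rg th r) - r).
  assert (cF : forall th r, continuity_2d_pt F th r).
  { intros th r. apply continuity_2d_pt_minus; apply continuity_2d_pt_mult; auto;
      repeat first [apply continuity_2d_pt_minus|apply continuity_2d_pt_const
                   |apply continuity_2d_pt_id1]. }
  assert (cH : forall th r, continuity_2d_pt H th r).
  { intros th r. apply continuity_2d_pt_minus; [|apply continuity_2d_pt_id2].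
    apply continuity_2d_pt_mult; [|apply continuity_2d_pt_plus; auto].
    apply (continuity_2d_comp X (fun th r => sup_pos T (shoot N th r)) (fun _ r => r)); auto.
    - apply continuity_sup_shoot.
    - apply continuity_2d_pt_id2. }
  assert (load0 : forall th r s, 0 <= load N th r s).
  { intros. now apply forcing_nonneg. }
  set (rho := fun x => r0 + x * (r1 - r0)).
  assert (crho : forall Q, (forall th r, continuity_2d_pt Q th r) ->
    forall x y, continuity_2d_pt (fun th x => Q th (rho x)) x y).
  { intros Q cQ x y. apply (continuity_2d_comp Q (fun th _ => th) (fun _ x => rho x)); auto.
    - apply continuity_2d_pt_id1.
    - apply continuity_2d_pt_plus; [apply continuity_2d_pt_const|].
      apply continuity_2d_pt_mult; [apply continuity_2d_pt_id2|apply continuity_2d_pt_const]. }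
  assert (F0 : forall r, 0 <= F 0 r).
  { intros r. unfold F. generalize (lft_nonneg
      (load N 0 r) (cont_load N 0 r) (load0 0 r)). unfold lf. lra. }
  assert (F1 : forall r, F 1 r <= 0).
  { intros r. unfold F. generalize (rgt_nonneg
      (load N 1 r) (cont_load N 1 r) (load0 1 r)). unfold rg. lra. }
  assert (rho0 : rho 0 = r0) by (unfold rho; ring).
  assert (rho1 : rho 1 = r1) by (unfold rho; ring).
  assert (Hzero : exists x y, 0 <= x <= 1 /\ 0 <= y <= 1 /\ F x (rho y) = 0 /\ H x (rho y) = 0).
  { destruct Hedges as [[e0 e1]|[e0 e1]].
    - apply (poincare_miranda (fun th x => F th (rho x)) (fun th x => H th (rho x))); auto.
      + intros x Hx. rewrite rho0. apply (e0 x); auto.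
      + intros x Hx. rewrite rho1. apply (e1 x); auto.
    - destruct (poincare_miranda (fun th x => F th (rho x)) (fun th x => - H th (rho x)))
        as (x & y & hx & hy & h1 & h2); auto.
      + intros x y. apply continuity_2d_pt_opp. now apply crho.
      + intros x Hx. rewrite rho0. generalize (e0 x _ Hx (Hsol x r0)).
        unfold H, lf, rg, balance, load; lra.
      + intros x Hx. rewrite rho1. generalize (e1 x _ Hx (Hsol x r1)).
        unfold H, lf, rg, balance, load; lra.
      + exists x, y. repeat split; lra. }
  destruct Hzero as (th & y & Hth & Hy & h1 & h2).
  exists th, (rho y), (shoot N th (rho y)).
  split; [assumption|]. split; [unfold rho; nra|]. split; [apply Hsol|].
  unfold H in h2. unfold F in h1. unfold lf, rg, load in h1, h2.
  set (P := lft _) in *. set (Q := rgt _) in *.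
  set (x := X _ _) in *.
  assert (e : rho y = x * (P + Q)) by lra. rewrite e.
  split.
  - replace (x * (P + Q) * th) with (x * (th * P + th * Q)) by ring.
    replace (th * Q) with ((1 - th) * P) by lra. ring.
  - replace (x * (P + Q) * (1 - th)) with (x * ((1 - th) * P + (1 - th) * Q)) by ring.
    replace ((1 - th) * P) with (th * Q) by lra. ring.
Qed.

End PolarFixedPoint.

(** * The two solutions *)

Section Existence.

Variables (a f : R -> R).
Hypothesis ca : cont a.
Hypothesis cf : cont f.
Hypothesis a0 : forall t, 0 <= a t.
Hypothesis f0 : forall x, 0 <= f x.

(** Strictly below T, because the weight T - s vanishes at T. *)
Variable t1 : R.
Hypothesis Ht1 : eta <= t1 < T.
Hypothesis a_t1 : 0 < a t1.

Lemma cont_weight : cont (fun s => (T - s) * a s).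
Proof.
  apply (cont_mult (fun s => T - s)); [|assumption].
  apply cont_minus; [apply cont_const|apply cont_id].
Qed.

Lemma weight_pos (c : R) : c <= eta -> 0 < RInt (fun s => (T - s) * a s) c T.
Proof.
  intros Hc. apply RInt_pos with t1; try lra.
  - apply cont_weight.
  - intros s Hs. apply Rmult_le_pos; [lra|apply a0].
  - apply Rmult_lt_0_compat; lra.
Qed.

Lemma prim2_a_pos : 0 < prim (prim a) T.
Proof.
  generalize (weight_pos 0 ltac:(lra)). rewrite prim2_taylor, !prim_0 by assumption. lra.
Qed.

Lemma mid_a_pos : 0 < mid a.
Proof.
  generalize (mid_gain a ca a0) (weight_pos eta ltac:(lra)); intros h1 h2.
  assert (0 < 2 * eta * RInt (fun s => (T - s) * a s) eta T) by (apply Rmult_lt_0_compat; lra).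
  apply Rmult_lt_reg_l with bvp_det; lra.
Qed.

(** The radius that belongs to the right-hand side [a]. Bounds of a forcing by multiples of [a]
    become bounds of its radius by multiples of [total]. *)
Definition total : R := lft a + rgt a.

Lemma total_pos : 0 < total.
Proof.
  unfold total. generalize (lft_nonneg a ca a0) (rgt_ge a ca a0) prim2_a_pos. lra.
Qed.

Lemma total_le (y : R -> R) (k : R) : cont y -> (forall s, y s <= k * a s) ->
  lft y + rgt y <= k * total.
Proof.
  intros cy H.
  assert (1 * lft y <= k * lft a) by (apply lft_le; auto; intros s; generalize (H s); lra).
  assert (1 * rgt y <= k * rgt a) by (apply rgt_le; auto; intros s; generalize (H s); lra).
  unfold total. lra.
Qed.

Lemma total_ge (y : R -> R) (k : R) : cont y -> (forall s, k * a s <= y s) ->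
  k * total <= lft y + rgt y.
Proof.
  intros cy H.
  assert (k * lft a <= 1 * lft y) by (apply lft_le; auto; intros s; generalize (H s); lra).
  assert (k * rgt a <= 1 * rgt y) by (apply rgt_le; auto; intros s; generalize (H s); lra).
  unfold total. lra.
Qed.

(** The cutoff [x] multiplies the affine part only: x = 1 gives a genuine solution, and for x <= 1
    and a nonnegative forcing u <= x [sol y]. *)
Lemma delay_solution_sol (g mu : R -> R) (delta th r x : R) (u : R -> R) :
  delay_solution a g delta mu th r u ->
  let y := forcing T a g delta u (mu r) in
  x * lft y = r * th -> x * rgt y = r * (1 - th) ->
  forall t, 0 <= t <= T -> u t = x * sol y t - (1 - x) * prim (prim y) t.
Proof.
  intros [_ H] y e1 e2 t Ht. rewrite (H t Ht). fold y. unfold line.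
  rewrite <- e1, <- e2. unfold sol, rgt. field. lra.
Qed.

(* This is Lambda2 / gamma. *)
Definition expansion : R :=
  bvp_det / (2 * gam ^ 2 * eta * RInt (fun s => (T - s) * a s) eta T).

Lemma expansion_pos : 0 < expansion.
Proof.
  generalize gamma_pos (weight_pos eta ltac:(lra)); intros.
  unfold expansion. apply Rdiv_lt_0_compat; [assumption|].
  repeat apply Rmult_lt_0_compat; lra.
Qed.

(* The solution would exceed its own supremum at eta. *)
Lemma expansion_bound (g u : R -> R) (delta c : R) : cont g -> (forall x, 0 <= g x) ->
  cont u -> 0 < delta -> delta < eta * (1 - gam) -> 0 <= c ->
  (forall t, 0 <= t <= T -> u t = sol (forcing T a g delta u c) t) ->
  (forall v, gam ^ 2 * sup_pos T u <= v <= sup_pos T u -> expansion * v <= g v) ->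
  sup_pos T u <= 0.
Proof.
  intros cg g0 cu Hd Hdg Hc Hu Hg. apply Rnot_lt_le; intros HM.
  set (y := forcing T a g delta u c) in *.
  assert (cy : cont y) by (now apply cont_forcing).
  assert (y0 : forall s, 0 <= y s) by (intros; now apply forcing_nonneg).
  destruct (sup_pos_spec T u ltac:(lra) cu) as [hle (x & Hx & hx)].
  set (M := sup_pos T u) in *.
  assert (hx' : M = u x).
  { revert hx. apply Rmax_case_strong; lra. }
  generalize gamma_pos gamma_lt_1; intros gp gl.
  set (I := RInt (fun s => (T - s) * a s) eta T).
  assert (Ipos : 0 < I) by (apply weight_pos; lra).
  (* s - delta may fall left of eta. Concavity and a nonnegative value at 0 limit the loss to the
     factor (eta - delta) / eta, which the bound on delta keeps above gamma. *)
  set (q := 1 - delta / eta).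
  assert (Hq : gam < q).
  { unfold q. apply Rmult_lt_reg_l with eta; [lra|].
    replace (eta * (1 - delta / eta)) with (eta - delta) by (field; lra). lra. }
  assert (Hv : forall s, eta <= s <= T -> q * gam * M <= u (clamp T (s - delta))).
  { intros s Hs.
    assert (de : delta < eta) by nra.
    rewrite clamp_id by lra. rewrite Hu, hx', Hu by lra.
    generalize (sol_cone y eta x cy y0 ltac:(lra) Hx); intros h1.
    assert (m0 : 0 <= sol y x) by (apply sol_nonneg; auto).
    assert (q1 : q < 1).
    { unfold q. assert (0 < delta / eta) by (apply Rdiv_lt_0_compat; lra). lra. }
    assert (gm0 : 0 <= gam * sol y x) by (apply Rmult_le_pos; lra).
    rewrite Rmult_assoc.
    destruct (Rle_dec eta (s - delta)) as [h|h].
    - generalize (sol_cone y (s - delta) x cy y0 ltac:(lra) Hx). nra.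
    - generalize (sol_concave y 0 (s - delta) eta cy y0 ltac:(lra)). rewrite sol_0.
      generalize (lft_nonneg y cy y0); intros l0 h2.
      assert (h3 : (s - delta) * sol y eta <= eta * sol y (s - delta)) by nra.
      apply Rmult_le_reg_l with eta; [lra|]. apply Rle_trans with (2 := h3).
      apply Rle_trans with ((s - delta) * (gam * sol y x)).
      + rewrite <- Rmult_assoc. apply Rmult_le_compat_r; [assumption|].
        unfold q. replace (eta * (1 - delta / eta)) with (eta - delta) by (field; lra). lra.
      + apply Rmult_le_compat_l; lra. }
  assert (Hy : forall s, eta <= s <= T -> expansion * (q * gam * M) * a s <= y s).
  { intros s Hs. unfold y, forcing. rewrite (Rmult_comm (a s)).
    apply Rmult_le_compat_r; [apply a0|].
    generalize (Hv s Hs); intros h.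
    assert (h2 : u (clamp T (s - delta)) <= M) by (apply hle, clamp_bounds; lra).
    apply Rle_trans with (expansion * u (clamp T (s - delta))).
    - apply Rmult_le_compat_l; [left; apply expansion_pos|assumption].
    - assert (gam ^ 2 * M <= u (clamp T (s - delta))).
      { apply Rle_trans with (2 := h). apply Rmult_le_compat_r; [lra|]. nra. }
      generalize (Hg (u (clamp T (s - delta))) ltac:(lra)). lra. }
  assert (HI : expansion * (q * gam * M) * I <= RInt (fun s => (T - s) * y s) eta T).
  { unfold I. rewrite <- (RInt_scal (V := R_CompleteNormedModule)) by apply cont_ex_RInt, cont_weight.
    apply RInt_le; [lra| | |].
    - apply cont_ex_RInt. intros s. apply (continuous_scal_r (V := R_NormedModule)), cont_weight.
    - apply cont_ex_RInt, (cont_mult (fun s => T - s)); [|assumption].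
      apply cont_minus; [apply cont_const|apply cont_id].
    - intros s Hs. unfold scal; simpl; unfold mult; simpl.
      generalize (Hy s ltac:(lra)); intros h.
      apply Rmult_le_compat_l with (r := T - s) in h; [|lra]. lra. }
  generalize (mid_gain y cy y0); intros hgain.
  assert (hm : mid y <= M).
  { rewrite <- sol_eta, <- Hu by lra. apply hle; lra. }
  (* This amounts to u(eta) >= (q / gamma) M with q > gamma. *)
  assert (e : 2 * eta * (expansion * (q * gam * M) * I) = bvp_det * (q / gam * M)).
  { unfold expansion. fold I. field. repeat split; lra. }
  assert (h1 : bvp_det * (q / gam * M) <= bvp_det * M).
  { rewrite <- e. apply Rle_trans with (bvp_det * mid y).
    - apply Rle_trans with (2 := hgain). apply Rmult_le_compat_l; lra.
    - apply Rmult_le_compat_l; lra. }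
  apply Rmult_le_reg_l in h1; [|assumption].
  assert (1 < q / gam).
  { apply Rmult_lt_reg_r with gam; [assumption|]. field_simplify; lra. }
  nra.
Qed.

(** The bound [Y] makes the forcing at most Y a, hence the [u n] bounded and equi-Lipschitz. The
    Lipschitz constant also controls the effect of the delay, so it disappears in the limit. *)
Lemma limit_solution (g : R -> R) (Y B : R) (u : nat -> R -> R) (delta c : nat -> R) :
  cont g -> (forall x, 0 <= g x) -> (forall n, cont (u n)) ->
  (forall n, 0 < delta n <= B * / INR (S n)) -> (forall n, 0 <= c n <= B * / INR (S n)) ->
  (forall n t, 0 <= t <= T -> u n t = sol (forcing T a g (delta n) (u n) (c n)) t) ->
  (forall n t, 0 <= t <= T -> g (u n t) + c n <= Y) ->
  exists w, cont w /\
    (forall t, 0 <= t <= T -> w t = sol (fun s => a s * g (w s)) t) /\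
    forall e, 0 < e -> exists n, forall t, 0 <= t <= T -> Rabs (u n t - w t) <= e.
Proof.
  intros cg g0 cu Hd Hc Hu HY.
  set (y := fun n => forcing T a g (delta n) (u n) (c n)).
  change (forall n t, 0 <= t <= T -> u n t = sol (y n) t) in Hu.
  assert (cy : forall n, cont (y n)) by (intros; now apply cont_forcing).
  assert (Hy : forall n s, 0 <= y n s <= Y * a s).
  { intros n s. split; [apply forcing_nonneg; auto; apply Hc|].
    unfold y, forcing. rewrite (Rmult_comm Y). apply Rmult_le_compat_l; [apply a0|].
    apply HY, clamp_bounds. lra. }
  assert (Y0 : 0 <= Y).
  { generalize (HY 0%nat 0 ltac:(lra)) (g0 (u 0%nat 0)) (Hc 0%nat); lra. }
  set (L := Y * (total / T + prim a T) + 1).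
  assert (HL : 0 < L).
  { unfold L. assert (0 <= prim a T) by (apply prim_nonneg with T; auto; lra).
    assert (0 < total / T) by (apply Rdiv_lt_0_compat; [apply total_pos|lra]). nra. }
  assert (Hlip : forall n s t, 0 <= s <= T -> 0 <= t <= T ->
    Rabs (u n t - u n s) <= L * Rabs (t - s)).
  { intros n s t Hs Ht. rewrite (Hu n t Ht), (Hu n s Hs).
    eapply Rle_trans; [apply (sol_lipschitz a (y n) Y); auto|].
    apply Rmult_le_compat_r; [apply Rabs_pos|]. unfold L, total. lra. }
  destruct (cont_bounded T (sol a) ltac:(lra) (cont_sol a ca)) as (M & M0 & HM).
  destruct (equilipschitz_cluster T (Y * M) L u) as (w & cw & Hw); auto; [lra| |].
  { intros n t Ht. rewrite (Hu n t Ht).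
    rewrite Rabs_pos_eq by (apply sol_nonneg; auto; intros; apply Hy).
    apply Rle_trans with (Y * sol a t).
    - rewrite <- (Rmult_1_l (sol _ t)). apply sol_le; auto.
      intros s. generalize (Hy n s); unfold y; lra.
    - apply Rmult_le_compat_l; [assumption|]. apply Rle_trans with (2 := HM t Ht). apply Rle_abs. }
  exists w. split; [assumption|]. split.
  2:{ intros e He. destruct (Hw e 0%nat He) as (n & _ & H). now exists n. }
  set (z := fun s => a s * g (w s)).
  assert (cz : cont z) by (apply cont_mult; [assumption|now apply cont_comp]).
  intros t Ht. apply cond_eq. intros e He.
  destruct sol_close as (C & C0 & HC).
  destruct (cont_bounded T a ltac:(lra) ca) as (Ma & Ma0 & HMa).
  set (e1 := e / (4 * C * (Ma + 1))).
  assert (e10 : 0 < e1) by (unfold e1; apply Rdiv_lt_0_compat; [lra|nra]).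
  destruct (comp_close T g w e1 ltac:(lra) cg cw e10) as (d & d0 & Hd1).
  assert (B0 : 0 < B).
  { generalize (Hd 0%nat). simpl. rewrite Rinv_1. lra. }
  (* A delay below d / (2 L) moves [u n] by at most d/2; the distance to [w] takes the other half of
     the modulus [d]. *)
  assert (dL : 0 < d / (2 * L)) by (apply Rdiv_lt_0_compat; lra).
  destruct (archimed_INR (Rmin (d / (2 * L)) e1 / B)) as [N HN].
  { apply Rdiv_lt_0_compat; [now apply Rmin_pos|assumption]. }
  destruct (Hw (Rmin (d / 2) (e / 4)) N) as (n & Hn & Hun); [apply Rmin_pos; lra|].
  specialize (HN n Hn).
  assert (HBn : B * / INR (S n) < Rmin (d / (2 * L)) e1).
  { apply Rmult_lt_compat_l with (r := B) in HN; [|assumption].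
    replace (B * (Rmin (d / (2 * L)) e1 / B)) with (Rmin (d / (2 * L)) e1) in HN
      by (field; lra). assumption. }
  generalize (Rmin_l (d / (2 * L)) e1) (Rmin_r (d / (2 * L)) e1)
    (Rmin_l (d / 2) (e / 4)) (Rmin_r (d / 2) (e / 4)) (Hd n) (Hc n); intros m1 m2 m3 m4 hd hc.
  assert (Hclose : forall s, 0 <= s <= T -> Rabs (y n s - z s) <= (Ma + 1) * (2 * e1)).
  { intros s Hs. unfold y, forcing, z.
    rewrite <- Rmult_minus_distr_l, Rabs_mult.
    apply Rmult_le_compat; try apply Rabs_pos.
    - generalize (HMa s Hs); lra.
    - set (s' := clamp T (s - delta n)).
      replace (g (u n s') + c n - g (w s)) with ((g (u n s') - g (w s)) + c n) by ring.
      eapply Rle_trans; [apply Rabs_triang|].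
      rewrite (Rabs_pos_eq (c n)) by lra.
      assert (h : Rabs (g (u n s') - g (w s)) <= e1); [|lra].
      apply Hd1; [assumption|].
      replace (u n s' - w s) with ((u n s' - u n s) + (u n s - w s)) by ring.
      eapply Rle_trans; [apply Rabs_triang|].
      generalize (Hun s Hs); intros h1.
      assert (h2 : Rabs (u n s' - u n s) <= L * (d / (2 * L))).
      { eapply Rle_trans; [apply Hlip; [assumption|apply clamp_bounds; lra]|].
        apply Rmult_le_compat_l; [lra|].
        rewrite <- (clamp_id T s Hs). unfold s'.
        eapply Rle_trans; [apply clamp_lipschitz|].
        replace (s - delta n - s) with (- delta n) by ring.
        rewrite Rabs_Ropp, Rabs_pos_eq by lra. lra. }
      replace (L * (d / (2 * L))) with (d / 2) in h2 by (field; lra). lra. }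
  destruct (HC (y n) z _ (cy n) cz Hclose) as (_ & _ & HCs).
  generalize (HCs t Ht); intros h.
  replace (C * ((Ma + 1) * (2 * e1))) with (e / 2) in h by (unfold e1; field; lra).
  generalize (Hun t Ht); rewrite (Hu n t Ht); fold (y n). intros h2.
  apply Rabs_le_between in h, h2. apply Rabs_def1; lra.
Qed.

(** * The solution of norm below [rho] *)

Variables (rho M1 : R).
Hypothesis Hrho : 0 < rho.
Hypothesis HM1 : 0 < M1.
Hypothesis HLambda :
  M1 * ((2 * T + 2 * beta * eta + alpha * beta * T ^ 2) * prim (prim a) T) <= bvp_det.
Hypothesis Hsmall : forall x, x <= rho -> f x <= M1 * rho.

Lemma sol_lt_rho (y : R -> R) (t : R) : cont y -> (forall s, 0 <= y s) ->
  (forall s, 0 <= s <= T -> y s <= M1 * rho * a s) -> 0 <= t <= T -> sol y t < rho.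
Proof.
  intros cy y0 H Ht.
  assert (hA : prim (prim y) T <= M1 * rho * prim (prim a) T).
  { assert (e : (fun s => M1 * rho * a s) = (fun s => M1 * rho * a s + 0 * a s)).
    { apply functional_extensionality; intros; ring. }
    apply Rle_trans with (prim (prim (fun s => M1 * rho * a s)) T).
    - rewrite e. apply prim_le with T; auto using cont_prim, cont_comb; [|lra].
      intros s Hs. apply prim_le with T; auto using cont_comb. intros r Hr.
      generalize (H r Hr); lra.
    - rewrite e, !prim_comb by auto using cont_prim. lra. }
  assert (A0 : 0 < M1 * rho * prim (prim a) T).
  { repeat apply Rmult_lt_0_compat; auto using prim2_a_pos. }
  generalize (sol_lt y _ t cy y0 A0 hA Ht); intros h.
  apply Rmult_lt_reg_l with bvp_det; [assumption|].
  apply Rlt_le_trans with (1 := h).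
  apply Rmult_le_compat_r with (r := rho) in HLambda; lra.
Qed.

Lemma delay_bound : 0 < eta * (1 - gam) / 2.
Proof. generalize gamma_lt_1; intros. assert (0 < eta * (1 - gam)) by nra. lra. Qed.

(** The factor 1/2 keeps every delay strictly below eta (1 - gamma), the threshold of
    [expansion_bound]. *)
Definition delay_at (n : nat) : R := eta * (1 - gam) / 2 * / INR (S n).

Lemma INR_S_inv (n : nat) : 0 < / INR (S n) <= 1.
Proof.
  assert (1 <= INR (S n)) by (rewrite S_INR; generalize (pos_INR n); lra).
  split; [apply Rinv_0_lt_compat; lra|]. rewrite <- Rinv_1. apply Rinv_le_contravar; lra.
Qed.

Lemma delay_at_bounds (n : nat) : 0 < delay_at n < eta * (1 - gam).
Proof.
  generalize delay_bound (INR_S_inv n); intros h1 h2. unfold delay_at. split; nra.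
Qed.

Lemma small_approximation (r delta eps : R) : 0 < r ->
  (forall x, 0 < x < r -> expansion * x <= f x) ->
  0 < delta < eta * (1 - gam) -> 0 < eps ->
  exists u, cont u /\
    (forall t, 0 <= t <= T ->
       u t = sol (forcing T a (fun x => f (Rmin rho x)) delta u eps) t) /\
    Rmin r rho <= sup_pos T u.
Proof.
  intros Hr Hzero Hd He.
  set (g := fun x => f (Rmin rho x)).
  assert (cg : cont g) by (apply (cont_comp f (Rmin rho)); [assumption|apply cont_Rmin]).
  assert (g0 : forall x, 0 <= g x) by (intros; apply f0).
  assert (g1 : forall x, g x <= M1 * rho) by (intros; apply Hsmall, Rmin_l).
  generalize total_pos; intros Np.
  assert (M1r : 0 < M1 * rho) by nra.
  assert (cy : forall u, cont u -> cont (forcing T a g delta u eps)).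
  { intros; now apply cont_forcing. }
  (* The forcing lies between eps a and (M1 rho + eps) a, so its radius exceeds eps total / 2 and
     stays below the outer radius: the compressive case. *)
  destruct (polar_fixed_point a g delta ltac:(lra) ca cg a0 g0 (fun _ => eps) (fun _ _ => 1)
    (cont_const eps) (fun _ => Rlt_le _ _ He) (fun m r => continuity_2d_pt_const m r 1)
    (eps * total / 2) ((M1 * rho + eps) * total + 1))
    as (th & s & u & Hth & Hs & Hsol & e1 & e2).
  - assert (0 < eps * total) by nra. assert (0 < M1 * rho * total) by nra. lra.
  - left. split; intros th u Hth [cu _]; unfold balance.
    + assert (eps * total <= lft (forcing T a g delta u eps) + rgt (forcing T a g delta u eps)).
      { apply total_ge; auto. intros x. unfold forcing. rewrite Rmult_comm.
        apply Rmult_le_compat_l; [apply a0|].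
        generalize (g0 (u (clamp T (x - delta)))); lra. }
      assert (0 < eps * total) by nra. lra.
    + assert (lft (forcing T a g delta u eps) + rgt (forcing T a g delta u eps)
        <= (M1 * rho + eps) * total).
      { apply total_le; auto. intros x. unfold forcing. rewrite (Rmult_comm (M1 * rho + eps)).
        apply Rmult_le_compat_l; [apply a0|].
        generalize (g1 (u (clamp T (x - delta)))); lra. }
      lra.
  - generalize (delay_solution_sol g (fun _ => eps) delta th s 1 u Hsol e1 e2); intros Hu.
    destruct Hsol as [cu _].
    assert (Hu' : forall t, 0 <= t <= T -> u t = sol (forcing T a g delta u eps) t).
    { intros t Ht. rewrite (Hu t Ht). simpl. ring. }
    exists u. split; [assumption|]. split; [assumption|].
    assert (Hpos : 0 < sup_pos T u).
    { destruct (sup_pos_spec T u ltac:(lra) cu) as [h _].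
      apply Rlt_le_trans with (2 := h eta ltac:(lra)).
      rewrite Hu', sol_eta by lra.
      apply Rlt_le_trans with (eps * mid a).
      - apply Rmult_lt_0_compat; [assumption|apply mid_a_pos].
      - apply Rle_trans with (1 * mid (forcing T a g delta u eps)); [|lra].
        apply mid_le; auto. intros x. unfold forcing. rewrite Rmult_1_l, Rmult_comm.
        apply Rmult_le_compat_l; [apply a0|].
        generalize (g0 (u (clamp T (x - delta)))); lra. }
    (* Below min(r, rho) the truncation is inactive and [f] is expanding, so the supremum would have
       to vanish. The bound obtained does not depend on eps. *)
    apply Rnot_lt_le; intros Hlt.
    generalize (Rmin_l r rho) (Rmin_r r rho); intros m1 m2.
    assert (sup_pos T u <= 0); [|lra].
    apply (expansion_bound g u delta eps); auto; try lra.
    intros v Hv. unfold g. rewrite Rmin_right by lra. apply Hzero.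
    generalize gamma_pos; intros. split; [|lra].
    assert (0 < gam ^ 2 * sup_pos T u); [|lra]. apply Rmult_lt_0_compat; nra.
Qed.

Lemma small_solution (r : R) : 0 < r ->
  (forall x, 0 < x < r -> expansion * x <= f x) ->
  exists w, cont w /\
    (forall t, 0 <= t <= T -> w t = sol (fun s => a s * f (w s)) t) /\
    0 < sup_pos T w < rho.
Proof.
  intros Hr Hzero.
  set (g := fun x => f (Rmin rho x)).
  assert (cg : cont g) by (apply (cont_comp f (Rmin rho)); [assumption|apply cont_Rmin]).
  assert (g0 : forall x, 0 <= g x) by (intros; apply f0).
  assert (g1 : forall x, g x <= M1 * rho) by (intros; apply Hsmall, Rmin_l).
  pose (Hex := fun n => small_approximation r (delay_at n) (/ INR (S n)) Hr Hzero
    (delay_at_bounds n) (proj1 (INR_S_inv n))).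
  pose (u := fun n => proj1_sig (constructive_indefinite_description _ (Hex n))).
  assert (Hu : forall n, cont (u n) /\
    (forall t, 0 <= t <= T -> u n t = sol (forcing T a g (delay_at n) (u n) (/ INR (S n))) t) /\
    Rmin r rho <= sup_pos T (u n)).
  { intros n. unfold u. destruct constructive_indefinite_description as [v Hv]. exact Hv. }
  generalize delay_bound; intros db.
  destruct (limit_solution g (M1 * rho + 1) (eta * (1 - gam) / 2 + 1) u delay_at
    (fun n => / INR (S n))) as (w & cw & Hw & Hclose); auto.
  - intros n. apply Hu.
  - intros n. split; [apply delay_at_bounds|]. unfold delay_at.
    generalize (INR_S_inv n); nra.
  - intros n. generalize (INR_S_inv n); nra.
  - intros n. apply Hu.
  - intros n t _. generalize (g1 (u n t)) (INR_S_inv n); lra.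
  - assert (cz : cont (fun s => a s * g (w s))) by (apply cont_mult; [assumption|now apply cont_comp]).
    (* The limit stays below [rho], where the truncated nonlinearity equals [f]. *)
    assert (Hlt : forall t, 0 <= t <= T -> w t < rho).
    { intros t Ht. rewrite (Hw t Ht). apply sol_lt_rho; auto.
      - intros s. now apply Rmult_le_pos.
      - intros s _. rewrite (Rmult_comm (M1 * rho)). apply Rmult_le_compat_l; auto. }
    exists w. split; [assumption|]. split; [|split].
    + intros t Ht. rewrite (Hw t Ht). unfold sol at 1 2, lft, slope, mid.
      (* The two right-hand sides agree only on [0, T], so the equality is carried through the
         primitives one by one. *)
      assert (e1 : forall s, 0 <= s <= T ->
        prim (fun s => a s * g (w s)) s = prim (fun s => a s * f (w s)) s).
      { intros s Hs. apply prim_ext with T; [|assumption]. intros x Hx.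
        unfold g. rewrite Rmin_right; [reflexivity|]. left. auto. }
      assert (e2 : forall s, 0 <= s <= T -> prim (prim (fun s => a s * g (w s))) s
        = prim (prim (fun s => a s * f (w s))) s).
      { intros s Hs. apply prim_ext with T; assumption. }
      assert (e3 : prim (prim (prim (fun s => a s * g (w s)))) eta
        = prim (prim (prim (fun s => a s * f (w s)))) eta).
      { apply prim_ext with T; [assumption|lra]. }
      rewrite !e2, e3 by lra. reflexivity.
    + assert (hm : 0 < Rmin r rho) by now apply Rmin_pos.
      destruct (Hclose (Rmin r rho / 2) ltac:(lra)) as [n Hn].
      generalize (sup_pos_close T _ (u n) w ltac:(lra) (proj1 (Hu n)) cw Hn); intros h.
      destruct (Hu n) as (_ & _ & h2). apply Rabs_le_between in h. lra.
    + destruct (sup_pos_spec T w ltac:(lra) cw) as [_ (x & Hx & ->)].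
      apply Rmax_lub_lt; auto.
Qed.

(** * The solution of norm above [rho] *)

Section LargeSolution.

Variable Rinf : R.
Hypothesis HRinf : 0 < Rinf.
Hypothesis Hinf : forall x, Rinf < x -> expansion * x <= f x.
Hypothesis Hneg : forall x, x <= 0 -> f x = f 0.

(** If the supremum M exceeded it, all of [gamma^2 M, M] would lie beyond [Rinf], where [f] is
    expanding. *)
Definition apriori : R := Rinf / gam ^ 2.

Lemma apriori_pos : 0 < apriori.
Proof.
  generalize gamma_pos; intros. apply Rdiv_lt_0_compat; [assumption|].
  apply pow_lt; assumption.
Qed.

Lemma apriori_bound (u : R -> R) (delta c : R) : cont u ->
  0 < delta < eta * (1 - gam) -> 0 <= c ->
  (forall t, 0 <= t <= T -> u t = sol (forcing T a f delta u c) t) ->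
  sup_pos T u <= apriori.
Proof.
  intros cu Hd Hc Hu. apply Rnot_lt_le; intros Hlt. generalize apriori_pos; intros.
  assert (sup_pos T u <= 0); [|lra].
  apply (expansion_bound f u delta c); auto; try lra.
  intros v Hv. apply Hinf. apply Rlt_le_trans with (2 := proj1 Hv).
  generalize gamma_pos; intros gp.
  apply Rmult_lt_compat_l with (r := gam ^ 2) in Hlt; [|now apply pow_lt].
  unfold apriori in Hlt.
  replace (gam ^ 2 * (Rinf / gam ^ 2)) with Rinf in Hlt by (field; lra). assumption.
Qed.

Lemma large_approximation : exists Y, forall delta, 0 < delta < eta * (1 - gam) ->
  exists u, cont u /\
    (forall t, 0 <= t <= T -> u t = sol (forcing T a f delta u 0) t) /\
    rho <= sup_pos T u /\ (forall t, 0 <= t <= T -> f (u t) <= Y).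
Proof.
  generalize apriori_pos mid_a_pos total_pos; intros R0p map tp.
  destruct (cont_bounded apriori f ltac:(lra) cf) as (F & F0 & HF).
  assert (HF' : forall x, x <= apriori -> f x <= F).
  { intros x Hx. destruct (Rle_dec x 0) as [h|h].
    - rewrite (Hneg x h). apply Rle_trans with (1 := Rle_abs _). apply HF; lra.
    - apply Rle_trans with (1 := Rle_abs _). apply HF; lra. }
  exists F. intros delta Hd.
  (* [G] bounds the factor of [a] in the forcing in both situations met below: supremum under [rho],
     or a genuine solution with extra forcing at most apriori / mid a. [C] bounds the corresponding
     radius. *)
  set (G := Rmax (M1 * rho) (F + apriori / mid a)).
  assert (G1 : M1 * rho <= G) by apply Rmax_l.
  assert (G2 : F + apriori / mid a <= G) by apply Rmax_r.
  assert (M1r : 0 < M1 * rho) by nra.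
  set (C := G * total).
  assert (C0 : 0 < C) by (unfold C; nra).
  set (top := C + rho + 1).
  (* Zero up to radius C + rho, and top / total at [top], just enough to make the balance
     nonnegative there. *)
  set (mu := fun r => top / total * Rmax 0 (r - (C + rho))).
  assert (tt : 0 < top / total) by (apply Rdiv_lt_0_compat; unfold top; lra).
  assert (cmu : cont mu).
  { apply (cont_mult (fun _ => top / total)); [apply cont_const|].
    apply (cont_comp (Rmax 0)); [apply cont_Rmax|].
    apply cont_minus; [apply cont_id|apply cont_const]. }
  assert (mu0 : forall r, 0 <= mu r).
  { intros r. apply Rmult_le_pos; [lra|apply Rmax_l]. }
  (* In [m] the cutoff rises linearly from 0 at rho/2 to 1 at [rho]. Taking the maximum with r - C
     makes it 1 for r >= C + rho, whatever the supremum. *)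
  set (X := fun m r => Rmax 0 (Rmin 1 (2 * Rmax m (r - C) / rho - 1))).
  assert (cX : forall m r, continuity_2d_pt X m r).
  { assert (c1 : forall h, cont h -> forall Q, (forall m r, continuity_2d_pt Q m r) ->
      forall m r, continuity_2d_pt (fun m r => h (Q m r)) m r).
    { intros h ch Q cQ m r. apply (continuity_1d_2d_pt_comp h Q); [|apply cQ].
      apply continuity_pt_filterlim, ch. }
    assert (cm : forall m r, continuity_2d_pt (fun m r => Rmax m (r - C)) m r).
    { intros m r. apply continuity_2d_pt_ext with (fun m r => m + Rmax 0 (r - C - m)).
      - intros x y. apply Rmax_case_strong; apply Rmax_case_strong; lra.
      - apply continuity_2d_pt_plus; [apply continuity_2d_pt_id1|].
        apply (c1 (Rmax 0) (cont_Rmax 0) (fun m r => r - C - m)).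
        intros x y. repeat apply continuity_2d_pt_minus;
          first [apply continuity_2d_pt_id2|apply continuity_2d_pt_id1|apply continuity_2d_pt_const]. }
    apply (c1 (fun v => Rmax 0 (Rmin 1 (2 * v / rho - 1)))); [|assumption].
    apply (cont_comp (Rmax 0)); [apply cont_Rmax|].
    apply (cont_comp (Rmin 1)); [apply cont_Rmin|].
    apply is_derive_cont with (fun _ => 2 / rho). intros v. auto_derive; [trivial|].
    field. lra. }
  assert (X1 : forall m r, rho <= Rmax m (r - C) -> X m r = 1).
  { intros m r h. unfold X.
    assert (2 <= 2 * Rmax m (r - C) / rho).
    { apply Rmult_le_reg_r with rho; [assumption|].
      replace (2 * Rmax m (r - C) / rho * rho) with (2 * Rmax m (r - C)) by (field; lra). lra. }
    rewrite Rmin_left, Rmax_right; lra. }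
  assert (cy : forall u c, cont u -> cont (forcing T a f delta u c)).
  { intros; now apply cont_forcing. }
  destruct (polar_fixed_point a f delta (proj1 Hd) ca cf a0 f0 mu X cmu mu0 cX (rho / 2) top)
    as (th & r & u & Hth & Hr & Hsol & e1 & e2).
  - unfold top; lra.
  - right. split; intros th u Hth [cu Hu]; unfold balance.
    (* At the inner radius u lies below its affine part, hence below rho/2. The cutoff is 0 and the
       balance equals - rho/2. *)
    + assert (hs : sup_pos T u <= rho / 2).
      { apply sup_pos_le; auto; try lra. intros t Ht. rewrite (Hu t Ht).
        assert (0 <= prim (prim (forcing T a f delta u (mu (rho / 2)))) t).
        { apply prim2_nonneg; auto; [|lra]. intros s. now apply forcing_nonneg. }
        assert (line th (rho / 2) t <= rho / 2); [|lra].
        assert (ht : 0 <= t / T <= 1).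
        { split; [apply Rmult_le_pos; [lra|left; apply Rinv_0_lt_compat; lra]|].
          apply Rmult_le_reg_r with T; [lra|]. field_simplify; lra. }
        unfold line. set (v := t / T) in *.
        assert (h : th * (1 - v) + (1 - th) * v <= 1) by nra.
        apply Rmult_le_compat_l with (r := rho / 2) in h; lra. }
      assert (e : X (sup_pos T u) (rho / 2) = 0).
      { unfold X.
        assert (2 * Rmax (sup_pos T u) (rho / 2 - C) / rho <= 1).
        { apply Rmult_le_reg_r with rho; [assumption|]. unfold Rdiv at 1.
          rewrite (Rmult_assoc _ (/ rho)), Rinv_l by lra.
          assert (Rmax (sup_pos T u) (rho / 2 - C) <= rho / 2) by (apply Rmax_lub; lra). lra. }
        apply Rmax_left. apply Rle_trans with (1 := Rmin_r _ _). lra. }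
      rewrite e. lra.
    + rewrite X1.
      2:{ apply Rle_trans with (2 := Rmax_r _ _). unfold top; lra. }
      assert (emu : mu top = top / total).
      { unfold mu. rewrite Rmax_right; unfold top; [|lra]. ring. }
      assert (h : top / total * total <= lft (forcing T a f delta u (mu top))
        + rgt (forcing T a f delta u (mu top))).
      { apply total_ge; auto. intros x. unfold forcing. rewrite emu, Rmult_comm.
        apply Rmult_le_compat_l; [apply a0|].
        generalize (f0 (u (clamp T (x - delta)))); lra. }
      replace (top / total * total) with top in h by (field; lra). lra.
  - generalize (delay_solution_sol f mu delta th r _ u Hsol e1 e2).
    destruct Hsol as [cu _].
    set (y := forcing T a f delta u (mu r)) in *. set (x := X (sup_pos T u) r) in *.
    intros Hu; simpl in Hu.
    assert (cy' : cont y) by (apply cy; assumption).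
    assert (y0 : forall s, 0 <= y s) by (intros; now apply forcing_nonneg).
    assert (er : r = x * (lft y + rgt y)) by lra.
    assert (t0 : 0 <= lft y + rgt y).
    { generalize (lft_nonneg y cy' y0) (rgt_nonneg y cy' y0). lra. }
    destruct (sup_pos_spec T u ltac:(lra) cu) as [hsup _].
    assert (x01 : 0 <= x <= 1).
    { unfold x, X. split; [apply Rmax_l|]. apply Rmax_lub; [lra|apply Rmin_l]. }
    assert (rle : forall k, (forall s, y s <= k * a s) -> r <= k * total).
    { intros k Hk. rewrite er. apply Rle_trans with (lft y + rgt y); [nra|].
      apply total_le; auto. }
    (* Otherwise x = 1 and u is a solution with forcing [mu r]. The a priori bound and mu r mid a <=
       u(eta) limit [mu r], so the forcing is at most G a and r <= C. *)
    assert (Hr1 : r <= C + rho).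
    { apply Rnot_lt_le; intros h.
      assert (ex : x = 1).
      { apply X1. apply Rle_trans with (2 := Rmax_r _ _). lra. }
      assert (Hu1 : forall t, 0 <= t <= T -> u t = sol y t).
      { intros t Ht. rewrite (Hu t Ht), ex. ring. }
      generalize (apriori_bound u delta (mu r) cu Hd (mu0 r) Hu1); intros hap.
      assert (hmu : mu r <= apriori / mid a).
      { apply Rmult_le_reg_r with (mid a); [assumption|].
        replace (apriori / mid a * mid a) with apriori by (field; lra).
        apply Rle_trans with (mid y).
        - rewrite <- (Rmult_1_l (mid y)). apply mid_le; auto.
          intros s. unfold y, forcing. rewrite Rmult_1_l, Rmult_comm.
          apply Rmult_le_compat_l; [apply a0|].
          generalize (f0 (u (clamp T (s - delta)))); lra.
        - rewrite <- sol_eta, <- Hu1 by lra. generalize (hsup eta ltac:(lra)); lra. }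
      assert (r <= C); [|lra]. apply rle. intros s. unfold y, forcing.
      rewrite (Rmult_comm G). apply Rmult_le_compat_l; [apply a0|].
      generalize (HF' (u (clamp T (s - delta)))).
      generalize (hsup (clamp T (s - delta)) (clamp_bounds T _ ltac:(lra))). lra. }
    assert (emu : mu r = 0).
    { unfold mu. rewrite Rmax_left by lra. ring. }
    (* If m = sup u were below [rho], then r <= C and the cutoff depends on m alone. From m <= x rho
       and x rho <= 2 m - rho follows rho <= m. *)
    assert (hrho : rho <= sup_pos T u).
    { apply Rnot_lt_le; intros hlt.
      assert (Hy : forall s, y s <= M1 * rho * a s).
      { intros s. unfold y, forcing. rewrite emu, Rplus_0_r, (Rmult_comm (M1 * rho)).
        apply Rmult_le_compat_l; [apply a0|]. apply Hsmall.
        generalize (hsup (clamp T (s - delta)) (clamp_bounds T _ ltac:(lra))). lra. }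
      assert (HrC : r <= C).
      { apply Rle_trans with (1 := rle _ Hy). unfold C. apply Rmult_le_compat_r; lra. }
      assert (hx : sup_pos T u <= x * rho).
      { apply sup_pos_le; auto; [lra|nra|]. intros t Ht. rewrite (Hu t Ht).
        assert (sol y t < rho) by (apply sol_lt_rho; auto).
        assert (0 <= prim (prim y) t) by (apply prim2_nonneg; auto; lra).
        assert (x * sol y t <= x * rho) by (apply Rmult_le_compat_l; lra).
        assert (0 <= (1 - x) * prim (prim y) t) by (apply Rmult_le_pos; lra). lra. }
      assert (em : Rmax (sup_pos T u) (r - C) = sup_pos T u).
      { apply Rmax_left. generalize (sup_pos_nonneg T u ltac:(lra) cu). lra. }
      assert (ex : x = Rmax 0 (Rmin 1 (2 * sup_pos T u / rho - 1))).
      { unfold x, X. now rewrite em. }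
      destruct (Rle_dec 0 (Rmin 1 (2 * sup_pos T u / rho - 1))) as [hm|hm].
      (* x = 0 would give r = 0, below the inner radius. *)
      2:{ rewrite Rmax_left in ex by lra. rewrite ex in er. lra. }
      - rewrite Rmax_right in ex by assumption.
        assert (hx2 : x <= 2 * sup_pos T u / rho - 1) by (rewrite ex; apply Rmin_r).
        apply Rmult_le_compat_r with (r := rho) in hx2; [|lra].
        replace ((2 * sup_pos T u / rho - 1) * rho) with (2 * sup_pos T u - rho) in hx2
          by (field; lra). lra. }
    assert (ex : x = 1).
    { apply X1. apply Rle_trans with (1 := hrho). apply Rmax_l. }
    assert (Hu1 : forall t, 0 <= t <= T -> u t = sol (forcing T a f delta u 0) t).
    { intros t Ht. rewrite (Hu t Ht), ex. unfold y. rewrite emu. ring. }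
    exists u. repeat split; auto. intros t Ht. apply HF'.
    apply Rle_trans with (1 := hsup t Ht). apply (apriori_bound u delta 0); auto. lra.
Qed.

Lemma large_solution : exists w, cont w /\
    (forall t, 0 <= t <= T -> w t = sol (fun s => a s * f (w s)) t) /\
    rho < sup_pos T w.
Proof.
  destruct large_approximation as (Y & HY).
  pose (Hex := fun n => HY (delay_at n) (delay_at_bounds n)).
  pose (u := fun n => proj1_sig (constructive_indefinite_description _ (Hex n))).
  assert (Hu : forall n, cont (u n) /\
    (forall t, 0 <= t <= T -> u n t = sol (forcing T a f (delay_at n) (u n) 0) t) /\
    rho <= sup_pos T (u n) /\ (forall t, 0 <= t <= T -> f (u n t) <= Y)).
  { intros n. unfold u. destruct constructive_indefinite_description as [v Hv]. exact Hv. }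
  generalize delay_bound; intros db.
  destruct (limit_solution f Y (eta * (1 - gam) / 2) u delay_at (fun _ => 0))
    as (w & cw & Hw & Hclose); auto.
  - intros n. apply Hu.
  - intros n. split; [apply delay_at_bounds|]. unfold delay_at. lra.
  - intros n. generalize (INR_S_inv n); nra.
  - intros n. apply Hu.
  - intros n t Ht. rewrite Rplus_0_r. now apply Hu.
  - exists w. split; [assumption|]. split; [assumption|].
    assert (hge : rho <= sup_pos T w).
    { apply Rnot_lt_le; intros hlt.
      destruct (Hclose ((rho - sup_pos T w) / 2) ltac:(lra)) as [n Hn].
      generalize (sup_pos_close T _ (u n) w ltac:(lra) (proj1 (Hu n)) cw Hn); intros h.
      destruct (Hu n) as (_ & _ & h2 & _). apply Rabs_le_between in h. lra. }
    (* The limit preserves only a weak inequality. If the supremum equalled [rho], the small-value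
       bound on [f] would hold along [w], and [sol_lt_rho] would put [w] strictly below [rho]. *)
    apply Rnot_le_lt; intros hle.
    destruct (sup_pos_spec T w ltac:(lra) cw) as [hsup (x & Hx & ex)].
    assert (w x < rho).
    { rewrite (Hw x Hx). apply sol_lt_rho; auto.
      - apply cont_mult; [assumption|now apply cont_comp].
      - intros s. now apply Rmult_le_pos.
      - intros s Hs. rewrite (Rmult_comm (M1 * rho)). apply Rmult_le_compat_l; auto.
        apply Hsmall. generalize (hsup s Hs); lra. }
    revert ex. apply Rmax_case_strong; lra.
Qed.

End LargeSolution.

End Existence.

(** * Return to the original data *)

Lemma Derive_n_sol (y : R -> R) : cont y -> Derive_n (sol y) 2 = (fun t => - y t).
Proof.
  intros cy. apply functional_extensionality; intros t.
  now apply is_derive_unique, is_derive_Derive_sol.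
Qed.

(** The witness is [sol y] rather than [w]: the two agree on [0, T], but only [sol y] comes with
    explicit derivatives. *)
Lemma positive_solution_sol (a f ah fh w : R -> R) : cont ah -> cont fh -> cont w ->
  (forall t, 0 <= ah t) -> (forall x, 0 <= fh x) ->
  (forall t, 0 <= t <= T -> ah t = a t) -> (forall x, 0 <= x -> fh x = f x) ->
  (forall t, 0 <= t <= T -> w t = sol (fun s => ah s * fh (w s)) t) ->
  0 < sup_pos T w ->
  exists u, positive_solution T eta alpha beta a f u /\ sup_norm T u = sup_pos T w.
Proof.
  intros cah cfh cw ah0 fh0 eah efh Hw Hpos.
  set (y := fun s => ah s * fh (w s)).
  change (forall t, 0 <= t <= T -> w t = sol y t) in Hw.
  assert (cy : cont y) by (apply cont_mult; [assumption|now apply cont_comp]).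
  assert (y0 : forall s, 0 <= y s) by (intros s; now apply Rmult_le_pos).
  assert (u0 : forall t, 0 <= t <= T -> 0 <= sol y t) by (intros; now apply sol_nonneg).
  destruct (sup_pos_spec T w ltac:(lra) cw) as [hw (x & Hx & ex)].
  assert (ewx : sup_pos T w = w x) by (revert ex; apply Rmax_case_strong; lra).
  exists (sol y). repeat split.
  - intros t _ P HP. generalize (cont_sol y cy t P HP). unfold filtermap, within.
    apply filter_imp. auto.
  - exists (slope y - prim y t). now apply is_derive_sol.
  - exists (- y t). now apply is_derive_Derive_sol.
  - rewrite Derive_n_sol by assumption. apply (continuous_opp (V := R_NormedModule)), cy.
  - intros t Ht. rewrite Derive_n_sol by assumption. rewrite <- Hw by lra.
    unfold y. rewrite eah, efh by (rewrite ?Hw; try apply u0; lra). ring.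
  - rewrite sol_0, sol_eta. reflexivity.
  - now apply sol_T.
  - exact u0.
  - intros t Ht.
    (* Strict positivity comes from the cone inequality on [eta, T] and from concavity with a
       nonnegative value at 0 on (0, eta). *)
    assert (hc : forall s, eta <= s <= T -> 0 < sol y s).
    { intros s Hs. apply Rlt_le_trans with (2 := sol_cone y s x cy y0 Hs Hx).
      rewrite <- Hw, <- ewx by assumption. apply Rmult_lt_0_compat; [apply gamma_pos|assumption]. }
    destruct (Rle_dec eta t) as [h|h]; [apply hc; lra|].
    generalize (sol_concave y 0 t eta cy y0 ltac:(lra)) (hc eta ltac:(lra)).
    rewrite sol_0. generalize (lft_nonneg y cy y0); intros.
    assert (0 < t * sol y eta) by (apply Rmult_lt_0_compat; lra).
    apply Rmult_lt_reg_l with eta; nra.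
  - destruct (sup_norm_spec T (sol y) ltac:(lra) (cont_sol y cy)) as [hs (x' & Hx' & ex')].
    apply Rle_antisym.
    + rewrite ex', Rabs_pos_eq by auto. rewrite <- Hw by assumption. now apply hw.
    + rewrite ewx, Hw by assumption. apply Rle_trans with (2 := hs x Hx). apply Rle_abs.
Qed.

End LinearProblem.

Lemma cont_retract (D : R -> Prop) (h p : R -> R) :
  continuous_on D h -> cont p -> (forall t, D (p t)) -> cont (fun t => h (p t)).
Proof.
  intros ch cp Dp t. apply filterlim_comp with (2 := ch (p t) (Dp t)).
  intros P HP. specialize (cp t _ HP). unfold filtermap in *.
  revert cp. apply filter_imp. auto.
Qed.

Theorem corollary4p4
  (T eta alpha beta : R)
  (Heta : 0 < eta < T)
  (Halpha : 0 < alpha < 2 * T / eta ^ 2)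
  (Hbeta : 0 <= beta <
     (2 * T - alpha * eta ^ 2) / (alpha * eta ^ 2 - 2 * eta + 2 * T))
  (f a : R -> R)
  (Hf_cont : continuous_on (fun x => 0 <= x) f)
  (Hf_nonneg : forall x, 0 <= x -> 0 <= f x)
  (Ha_cont : continuous_on (Icc 0 T) a)
  (Ha_nonneg : forall t, 0 <= t <= T -> 0 <= a t)
  (Ha_pos : exists t0, eta <= t0 <= T /\ 0 < a t0)
  (theta2 : R)
  (Htheta2 : 1 <= theta2)
  (rho1 M1 : R)
  (Hrho1 : 0 < rho1)
  (HM1 : 0 < M1 <= Lambda1 T eta alpha beta a)
  (Hf_small : forall x, 0 <= x <= rho1 -> f x <= M1 * rho1)
  (beta1 : R)
  (Hf_infty : is_lim (fun x => f x / x) p_infty (Finite beta1))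
  (Hbeta1 : theta2 / gamma T eta alpha beta * Lambda2 T eta alpha beta a < beta1)
  (alpha2 : R)
  (Hf_zero : filterlim (fun x => f x / x) (at_right 0) (locally alpha2))
  (Halpha2 : theta2 / gamma T eta alpha beta * Lambda2 T eta alpha beta a < alpha2) :
  exists u1 u2 : R -> R,
    positive_solution T eta alpha beta a f u1 /\
    positive_solution T eta alpha beta a f u2 /\
    0 < sup_norm T u1 /\ sup_norm T u1 < rho1 /\ rho1 < sup_norm T u2.
Proof.
  destruct Halpha as [al0 al1]. destruct Hbeta as [be0 be1].
  assert (eta2 : 0 < eta ^ 2) by (apply pow_lt; lra).
  assert (hal : alpha * eta ^ 2 < 2 * T).
  { apply Rmult_lt_compat_r with (r := eta ^ 2) in al1; [|assumption].
    replace (2 * T / eta ^ 2 * eta ^ 2) with (2 * T) in al1 by (field; lra). assumption. }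
  assert (hden : 0 < alpha * eta ^ 2 - 2 * eta + 2 * T).
  { assert (0 < alpha * eta ^ 2) by (apply Rmult_lt_0_compat; assumption). lra. }
  assert (Hdet : 0 < bvp_det T eta alpha beta).
  { unfold bvp_det.
    apply Rmult_lt_compat_r with (r := alpha * eta ^ 2 - 2 * eta + 2 * T) in be1; [|assumption].
    replace ((2 * T - alpha * eta ^ 2) / (alpha * eta ^ 2 - 2 * eta + 2 * T)
      * (alpha * eta ^ 2 - 2 * eta + 2 * T)) with (2 * T - alpha * eta ^ 2) in be1
      by (field; lra). lra. }
  (* Retractions extend the data to continuous nonnegative functions on the line; [fh] is constant
     on the negative axis. *)
  set (ah := fun t => a (clamp T t)). set (fh := fun x => f (Rmax 0 x)).
  assert (cah : cont ah).
  { apply (cont_retract (Icc 0 T) a (clamp T) Ha_cont (cont_clamp T)).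
    intros t. apply clamp_bounds. lra. }
  assert (cfh : cont fh).
  { apply (cont_retract (fun x => 0 <= x) f (Rmax 0) Hf_cont (cont_Rmax 0)).
    intros x. apply Rmax_l. }
  assert (ah0 : forall t, 0 <= ah t) by (intros; apply Ha_nonneg, clamp_bounds; lra).
  assert (fh0 : forall x, 0 <= fh x) by (intros; apply Hf_nonneg, Rmax_l).
  assert (eah : forall t, 0 <= t <= T -> ah t = a t).
  { intros t Ht. unfold ah. now rewrite clamp_id. }
  assert (efh : forall x, 0 <= x -> fh x = f x).
  { intros x Hx. unfold fh. now rewrite Rmax_right. }
  (* If t0 = T, continuity of [ah] supplies a point slightly to the left. *)
  assert (Ht1 : exists t1, eta <= t1 < T /\ 0 < ah t1).
  { destruct Ha_pos as (t0 & h0 & hpos). rewrite <- eah in hpos by lra.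
    destruct (Rlt_dec t0 T) as [h|h]; [now exists t0; split; [lra|]|].
    destruct (cah t0 _ (open_gt 0 (ah t0) hpos)) as [e He].
    generalize (cond_pos e); intros e0.
    exists (Rmax eta (T - e / 2)). split.
    - split; [apply Rmax_l|apply Rmax_lub_lt; lra].
    - apply He. unfold ball; simpl; unfold AbsRing_ball, abs, minus, plus, opp; simpl.
      replace t0 with T by lra. apply Rabs_def1; apply Rmax_case_strong; lra. }
  destruct Ht1 as (t1 & Ht1 & hat1).
  assert (gp : 0 < gamma T eta alpha beta) by (apply gamma_pos; assumption).
  assert (gl : gamma T eta alpha beta < 1) by (apply gamma_lt_1; assumption).
  assert (A0 : 0 < prim (prim ah) T) by (apply (prim2_a_pos T eta) with t1; assumption).
  assert (HLambda : M1 * ((2 * T + 2 * beta * eta + alpha * beta * T ^ 2) * prim (prim ah) T)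
    <= bvp_det T eta alpha beta).
  { destruct HM1 as [M0 HM]. unfold Lambda1 in HM. fold (bvp_det T eta alpha beta) in HM.
    replace (RInt (fun s => T * (T - s) * a s) 0 T) with (T * prim (prim ah) T) in HM.
    2:{ assert (eA : prim (prim ah) T = RInt (fun s => (T - s) * ah s) 0 T)
          by (rewrite prim2_taylor, !prim_0 by assumption; ring).
        rewrite eA, <- (RInt_scal (V := R_CompleteNormedModule))
          by (now apply cont_ex_RInt, cont_weight).
        apply (RInt_ext (V := R_CompleteNormedModule)). rewrite Rmin_left, Rmax_right by lra.
        intros s Hs. unfold scal; simpl; unfold mult; simpl. rewrite eah by lra. ring. }
    set (k := 2 * (beta + 1) + / T * beta * eta * (alpha * eta + 2) + alpha * beta * T) in *.
    assert (be_eta : 0 <= beta * eta * (alpha * eta)) by (repeat apply Rmult_le_pos; lra).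
    assert (beT : 0 <= beta * T) by (apply Rmult_le_pos; lra).
    assert (ekT : k * T = 2 * (beta + 1) * T + beta * eta * (alpha * eta + 2)
      + alpha * beta * T ^ 2) by (unfold k; field; lra).
    (* The difference is 2 beta T + alpha beta eta^2. *)
    assert (hk : 2 * T + 2 * beta * eta + alpha * beta * T ^ 2 <= k * T) by lra.
    assert (k0 : 0 < k * T).
    { assert (0 <= alpha * (beta * T ^ 2)) by (repeat apply Rmult_le_pos; try lra; nra).
      assert (0 <= beta * eta) by nra. lra. }
    replace (k * (T * prim (prim ah) T)) with (k * T * prim (prim ah) T) in HM by ring.
    assert (kA : 0 < k * T * prim (prim ah) T) by (apply Rmult_lt_0_compat; assumption).
    apply Rle_div_r in HM; [|assumption].
    apply Rle_trans with (2 := HM). apply Rmult_le_compat_l; [lra|].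
    apply Rmult_le_compat_r; lra. }
  assert (Hsmall : forall x, x <= rho1 -> fh x <= M1 * rho1).
  { intros x Hx. apply Hf_small. split; [apply Rmax_l|apply Rmax_lub; lra]. }
  set (kappa := expansion T eta alpha beta ah).
  assert (k0 : 0 < kappa) by (apply expansion_pos with t1; assumption).
  assert (ek : kappa = Lambda2 T eta alpha beta a / gamma T eta alpha beta).
  { unfold kappa, expansion, Lambda2. fold (bvp_det T eta alpha beta).
    replace (RInt (fun s => (T - s) * a s) eta T) with (RInt (fun s => (T - s) * ah s) eta T).
    2:{ apply (RInt_ext (V := R_CompleteNormedModule)). rewrite Rmin_left, Rmax_right by lra.
        intros s Hs. rewrite eah by lra. reflexivity. }
    assert (0 < RInt (fun s => (T - s) * ah s) eta T)
      by (apply (weight_pos T eta) with t1; try assumption; lra).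
    field. repeat split; lra. }
  assert (hk : kappa <= theta2 / gamma T eta alpha beta * Lambda2 T eta alpha beta a).
  { replace (theta2 / gamma T eta alpha beta * Lambda2 T eta alpha beta a) with (theta2 * kappa)
      by (rewrite ek; field; lra). nra. }
  assert (Hinf : exists Rinf, 0 < Rinf /\ forall x, Rinf < x -> kappa * x <= fh x).
  { apply is_lim_spec in Hf_infty.
    destruct (Hf_infty (mkposreal (beta1 - kappa) ltac:(lra))) as [K HK].
    (* The rank [K] given by the limit may be negative; x must be positive to multiply f(x)/x by
       it. *)
    exists (Rmax K 1). split; [generalize (Rmax_r K 1); lra|]. intros x Hx.
    generalize (Rmax_l K 1) (Rmax_r K 1); intros.
    specialize (HK x ltac:(lra)). apply Rabs_def2 in HK. simpl in HK.
    rewrite efh by lra. replace (f x) with (f x / x * x) by (field; lra).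
    apply Rmult_le_compat_r; lra. }
  assert (Hzero : exists r, 0 < r /\ forall x, 0 < x < r -> kappa * x <= fh x).
  { destruct (Hf_zero (fun v => kappa < v)) as [e He].
    { apply (open_gt kappa). lra. }
    exists e. split; [apply cond_pos|]. intros x Hx.
    assert (h : kappa < f x / x).
    { apply He; [|lra].
      unfold ball; simpl; unfold AbsRing_ball, abs, minus, plus, opp; simpl.
      apply Rabs_def1; lra. }
    rewrite efh by lra. replace (f x) with (f x / x * x) by (field; lra).
    apply Rmult_le_compat_r; lra. }
  destruct Hinf as (Rinf & Ri0 & Hinf). destruct Hzero as (r & r0 & Hzero).
  destruct (small_solution T eta alpha beta Heta al0 be0 Hdet ah fh cah cfh ah0 fh0 t1 Ht1 hat1
    rho1 M1 Hrho1 (proj1 HM1) HLambda Hsmall r r0 Hzero) as (w1 & cw1 & Hw1 & s1).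
  destruct (large_solution T eta alpha beta Heta al0 be0 Hdet ah fh cah cfh ah0 fh0 t1 Ht1 hat1
    rho1 M1 Hrho1 (proj1 HM1) HLambda Hsmall Rinf Ri0 Hinf) as (w2 & cw2 & Hw2 & s2).
  { intros x Hx. unfold fh. rewrite !Rmax_left by lra. reflexivity. }
  destruct (positive_solution_sol T eta alpha beta Heta al0 be0 Hdet a f ah fh w1)
    as (u1 & P1 & e1); auto; [lra|].
  destruct (positive_solution_sol T eta alpha beta Heta al0 be0 Hdet a f ah fh w2)
    as (u2 & P2 & e2); auto; [lra|].
  exists u1, u2. rewrite e1, e2. repeat (split; [assumption|]). lra.
Qed.
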